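(* For each $T>0$, there exist positive constants $\delta,C_1,C_2$ such that $$-C_2|t-s|^{-3/2}\Delta s\,\Delta t\le E[(F(s)-F(s-\Delta s))(F(t+\Delta t)-F(t))]\le -C_1|t+\Delta t-(s-\Delta s)|^{-3/2}\Delta s\,\Delta t,$$ for all $0\le s<t\le T$, $\Delta s>0$, and $\Delta t>0$ such that $s-\Delta s\ge 0$, $|t-s|<\delta$, $\Delta s<\delta$, and $\Delta t<\delta$.
   Context: Fix $\alpha\in(0,1)$. Let $B=\{B(t):t\ge 0\}$ be a one-dimensional Brownian motion with random initial position, i.e. $B(t)=B(0)+W(t)$ with $W$ a standard Brownian motion started at $0$ and independent of $B(0)$. Assume $B(0)$ has a density $f\in C^\infty(\mathbb{R})$ that is a Schwartz function, i.e. $\sup_{x\in\mathbb{R}}(1+|x|^n)|f^{(m)}(x)|<\infty$ for all nonnegative integers $n,m$. Assume that $f(x)\,dx$ has a unique $\alpha$-quantile $q(0)$ (i.e. a unique number with $\int_{-\infty}^{q(0)}f(x)\,dx=\alpha$) and that $f(q(0))>0$. Let $u(x,t)$ denote the density of $B(t)$ (so $u(x,0)=f(x)$), and for $t>0$ let $q(t)$ be the (unique) $\alpha$-quantile of the law of $B(t)$. $F=\{F(t):t\ge 0\}$ is a centered Gaussian process (with continuous paths) with covariance function $$\rho(s,t)=E[F(s)F(t)]=\frac{P(B(s)\le q(s),\,B(t)\le q(t))-\alpha^2}{u(q(s),s)\,u(q(t),t)}.$$ Here $\Delta s$ and $\Delta t$ denote positive real numbers. *)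

(* Defs.v *)
From HB Require Import structures.
From mathcomp Require Import all_boot all_order all_algebra.
From mathcomp Require Import all_classical all_reals all_analysis.

Set Implicit Arguments.
Unset Strict Implicit.
Unset Printing Implicit Defensive.

Import Order.TTheory GRing.Theory Num.Theory.
Import numFieldNormedType.Exports.

Local Open Scope classical_set_scope.
Local Open Scope ring_scope.

Definition smooth (R : realType) (f : R -> R) : Prop :=
  forall (m : nat) (x : R), derivable (derive1n m f) x 1.

Definition schwartz (R : realType) (f : R -> R) : Prop :=
  smooth f /\
  forall n m : nat, exists M : R, forall x : R,
    (1 + `|x| ^+ n) * `|derive1n m f x| <= M.

Definition is_density (R : realType) (mu : set R -> \bar R) (g : R -> R) :
    Prop :=
  [/\ forall x, 0 <= g x,
      measurable_fun [set: R] g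
    & forall A, measurable A ->
        mu A = (\int[lebesgue_measure]_(x in A) (g x)%:E)%E].

(* This is the notion of quantile for laws without atoms, the only ones to
   which it is applied. *)
Definition is_quantile (R : realType) (alpha : R) (mu : set R -> \bar R)
    (x : R) : Prop :=
  mu `]-oo, x]%classic = alpha%:E.

(* [normal_prob m 0] is the uniform law on [0, 1], hence the case analysis. *)
Definition gaussian_law (R : realType) (m sigma : R) : set R -> \bar R :=
  if sigma == 0 then \d_m else normal_prob m sigma.

(* Processes below are indexed by [R], but only their restrictions to times
   [0 <= t] are constrained and used. *)

Definition sigma_process d (T : measurableType d) (R : realType)
    (P : probability T R) (X : R -> {RV P >-> R}) (I : set R) : set (set T) :=
  <<s \bigcup_(t in I) preimage_set_system setT (X t) measurable >>.

Definition indep_systems d (T : measurableType d) (R : realType)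
    (P : probability T R) (G H : set (set T)) : Prop :=
  forall A B, G A -> H B -> P (A `&` B) = (P A * P B)%E.

Definition continuous_paths d (T : measurableType d) (R : realType)
    (P : probability T R) (X : R -> {RV P >-> R}) : Prop :=
  {ae P, forall w, {within `[0, +oo[, continuous (fun t : R => X t w)}}.

Definition standard_brownian_motion d (T : measurableType d) (R : realType)
    (P : probability T R) (W : R -> {RV P >-> R}) : Prop :=
  [/\ forall w, W 0 w = 0,
      forall s t, 0 <= s -> s < t ->
        indep_systems P (sigma_process W `[0, s])
          (preimage_set_system setT (W t \- W s) measurable),
      forall s t, 0 <= s -> s < t ->
        forall A, measurable A ->
          P ((W t \- W s) @^-1` A) = normal_prob 0 (Num.sqrt (t - s)) A
    & continuous_paths W].

Definition brownian_motion d (T : measurableType d) (R : realType)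
    (P : probability T R) (B : R -> {RV P >-> R}) : Prop :=
  exists W : R -> {RV P >-> R},
    [/\ standard_brownian_motion W,
        indep_systems P (preimage_set_system setT (B 0) measurable)
          (sigma_process W `[0, +oo[)
      & forall t w, 0 <= t -> B t w = B 0 w + W t w].

Definition gaussian_process d (T : measurableType d) (R : realType)
    (P : probability T R) (F : R -> {RV P >-> R}) : Prop :=
  forall (n : nat) (t c : 'I_n -> R), (forall i, 0 <= t i) ->
    exists m sigma : R, forall A, measurable A ->
      P ((fun w => \sum_(i < n) c i * F (t i) w) @^-1` A) =
      gaussian_law m sigma A.

Definition quantile_cov d (T : measurableType d) (R : realType)
    (P : probability T R) (B : R -> {RV P >-> R}) (u : R -> R -> R)
    (q : R -> R) (alpha s t : R) : R :=
  (fine (P ([set w | B s w <= q s] `&` [set w | B t w <= q t])) - alpha ^+ 2)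
  / (u (q s) s * u (q t) t).

(* Main.v *)
Require Import Defs.
From HB Require Import structures.
From mathcomp Require Import all_boot all_order all_algebra.
From mathcomp Require Import all_classical all_reals all_analysis.
From mathcomp Require Import measurable_realfun ring lra.
Import Order.TTheory GRing.Theory Num.Theory.
Import numFieldNormedType.Exports.
Local Open Scope classical_set_scope.
Local Open Scope ring_scope.

(** Why the estimate holds.

Write C(x,t) for the distribution function of B(t), a(t) = u(q(t),t), b = 1/a,
and, for s < t, tau = t - s and z = q(t) - q(s). Let p_tau be the centered
Gaussian density of variance tau, called [heat] below. Expanding the product
of increments of F, the expectation is the mixed difference over
[s-Ds,s] x [t,t+Dt] of

   rho(s,t) = b(t) ((alpha - alpha^2) b(s) - b(s) K(s,t)),
   K(s,t) = P(B(s) <= q(s), B(t) > q(t)).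

As B(t) - B(s) is Gaussian and independent of B(s), K is the integral of
max(0, alpha - C(q(s)-y, s)) p_tau(y+z) over y. For y >= 0 the first factor is
a(s) y + O(y^2), so b(s) K(s,t) is the integral of (y+z) p_tau(y+z) over y >= 0,
which is tau p_tau(z) exactly, plus the integral of phi(s,t,y) p_tau(y+z) with
|phi| = O(y^2 + tau). Since q is Lipschitz, z = O(tau), hence tau p_tau(z)
behaves like sqrt(tau / (2 pi)), which enters rho with a minus sign. The mixed
derivative of sqrt(t - s) is tau^(-3/2) / 4, and every other contribution to the
mixed difference is O(tau^-1) Ds Dt: this gives both bounds when the times are
close.

Three devices keep the regularity requirements low.

- The only differentiation with respect to time takes place inside the
  explicit kernel. Over a rectangle, (tau,z) is replaced by its affine
  interpolation, along which [mean_value2] expresses the mixed differences of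
  p_tau(y+z) and of tau p_tau(z) exactly by second derivatives
  ([heat_mixedE], [heat_scaled_mixedE]); the factors a, b, q, phi enter through
  a discrete Leibniz rule and only need to be Lipschitz
  ([heat_mixed_integral_le], [rect_local_estimate]).

- The constants of this local estimate are uniform only when the sides of the
  rectangle are small compared with tau, so that all kernels involved are
  comparable. Mixed differences are additive under subdivision while tau^(-3/2)
  is monotone, so bisecting the rectangle removes the restriction
  ([rect_bisect]).

- C(.,t) is a Gaussian average of C(.,s). Averaging preserves uniform bounds on
  iterated increments in x, hence the bounds on f, f', f'' persist at all times,
  and bounds on symmetric second increments control increments in time
  ([evolves_bound], [evolves_time]). This makes u Lipschitz in both variables,
  uniformly down to time 0. The Lipschitz bound on q follows as in the implicit
  function theorem, because a is positive and continuous, hence bounded below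
  on compact intervals ([quantile_uniform]). *)

Set Implicit Arguments.
Unset Strict Implicit.
Unset Printing Implicit Defensive.

(** * Derivatives and mean value theorems *)

Section calc.
Context {R : realType}.
Implicit Types (f g : R -> R) (x a b c : R).

(** The rules below take functions as lambda-expressions, so that composing them
computes a derivative along with its proof. *)
Lemma der_cst c x : is_derive x 1 (fun=> c : R) 0.
Proof. exact: is_derive_cst. Qed.

Lemma der_eq f x a b : is_derive x 1 f a -> a = b -> is_derive x 1 f b.
Proof. by move=> df <-. Qed.

Lemma der_ext f g x a : f =1 g -> is_derive x 1 f a -> is_derive x 1 g a.
Proof. by move=> /funext ->. Qed.

Lemma der_id x : is_derive x 1 (fun y : R => y) 1.
Proof. exact: is_derive_id. Qed.

Lemma der_add f g x a b : is_derive x 1 f a -> is_derive x 1 g b ->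
  is_derive x 1 (fun y => f y + g y) (a + b).
Proof. by move=> df dg; exact: is_deriveD. Qed.

Lemma der_opp f x a : is_derive x 1 f a -> is_derive x 1 (fun y => - f y) (- a).
Proof. by move=> df; exact: is_deriveN. Qed.

Lemma der_mul f g x a b : is_derive x 1 f a -> is_derive x 1 g b ->
  is_derive x 1 (fun y => f y * g y) (a * g x + f x * b).
Proof.
move=> df dg; have H := is_deriveM df dg.
by apply: is_derive_eq H _; rewrite addrC /GRing.scale/= [g x * a]mulrC.
Qed.

Lemma der_inv f x a : is_derive x 1 f a -> f x != 0 ->
  is_derive x 1 (fun y => (f y)^-1) (- a / f x ^+ 2).
Proof.
move=> df f0; have H := is_deriveV f0 df.
by apply: is_derive_eq H _; rewrite /GRing.scale/= mulrC mulNr mulrN.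
Qed.

Lemma der_sqr f x a : is_derive x 1 f a ->
  is_derive x 1 (fun y => f y ^+ 2) (2 * f x * a).
Proof.
by move=> df; apply: (der_eq (is_deriveX 2 df)); rewrite /GRing.scale/= expr1.
Qed.

Lemma der_comp g f x a b : is_derive x 1 g b -> is_derive (g x) 1 f a ->
  is_derive x 1 (fun y => f (g y)) (a * b).
Proof. by move=> dg df; have H := is_derive1_comp df dg. Qed.

Lemma der_expR f x a : is_derive x 1 f a ->
  is_derive x 1 (fun y => expR (f y)) (a * expR (f x)).
Proof. by move=> df; have H := is_derive1_comp (is_derive_expR (f x)) df; rewrite mulrC. Qed.

Lemma der_ln f x a : is_derive x 1 f a -> 0 < f x ->
  is_derive x 1 (fun y => ln (f y)) (a / f x).
Proof. by move=> df f0; have H := is_derive1_comp (is_derive1_ln f0) df; rewrite mulrC. Qed.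

Lemma der_affine x a p : is_derive x 1 (fun y : R => a + y * p) p.
Proof.
by apply: (der_eq (der_add (der_cst a x) (der_mul (der_id x) (der_cst p x)))); rewrite add0r mul1r mulr0 addr0.
Qed.

Lemma mean_value f (df : R -> R) (a b : R) : a <= b ->
  (forall x, a <= x <= b -> is_derive x 1 f (df x)) ->
  exists2 c, a <= c <= b & f b - f a = df c * (b - a).
Proof.
move=> ab H.
have [||c cab E] := @MVT_segment R f df a b ab; last by exists c; [move: cab; rewrite in_itv|].
- by move=> x; rewrite in_itv/= => /andP[ax xb]; apply: H; rewrite !ltW.
- apply: derivable_within_continuous => x; rewrite in_itv/= => axb.
  by have := H _ axb => D; exact: ex_derive.
Qed.

(** Mean value theorem for mixed differences: it is applied to F(.,1) - F(.,0),
then to the partial derivative at the point so obtained. *)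
Lemma mean_value2 (F F1 F12 : R -> R -> R) :
  (forall l m : R, 0 <= l <= 1 -> 0 <= m <= 1 -> is_derive l 1 (F ^~ m) (F1 l m)) ->
  (forall l m : R, 0 <= l <= 1 -> 0 <= m <= 1 -> is_derive m 1 (F1 l) (F12 l m)) ->
  exists l m : R, [/\ 0 <= l <= 1, 0 <= m <= 1 &
    F 1 1 - F 1 0 - F 0 1 + F 0 0 = F12 l m].
Proof.
move=> d1 d12.
have i0 : 0 <= (0 : R) <= 1 by rewrite lexx ler01.
have i1 : 0 <= (1 : R) <= 1 by rewrite lexx ler01.
have [l l01 El] := mean_value (@ler01 R) (fun l hl => der_add (d1 l 1 hl i1) (der_opp (d1 l 0 hl i0))).
have [m m01 Em] := mean_value (@ler01 R) (fun m => d12 l m l01).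
exists l, m; split => //.
move: El Em; rewrite subr0 !mulr1 => El <-; rewrite -El; ring.
Qed.

End calc.

(** * The Gaussian kernel and its mixed differences *)

Section heat.
Context {R : realType}.
Implicit Types t x y z : R.

(** The Gaussian density of variance t. The factor 1 / sqrt t is inside the
exponential, so that every derivative of [heat] is [heat] times a rational
function. *)
Definition heat t x : R := expR (- x ^+ 2 / (2 * t) - ln t / 2) / Num.sqrt (2 * pi).

Lemma heat_normal_pdf m t x : 0 < t ->
  normal_pdf m (Num.sqrt t) x = heat t (x - m).
Proof.
move=> t0; rewrite normal_pdfE ?gt_eqF ?sqrtr_gt0//.
rewrite /normal_peak /normal_fun /heat sqr_sqrtr ?ltW// -[_ *+ 2]mulrnAr.
rewrite sqrtrM ?ltW// -[pi *+ 2]mulr_natl invfM mulrC mulrA; congr (_ / _).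
rewrite expRD -[_ *+ 2]mulr_natl; congr (_ * _).
rewrite -powR12_sqrt ?ltW// /powR gt_eqF// -expRN; congr expR.
by rewrite mulrC.
Qed.

Lemma heat_gt0 t x : 0 < heat t x.
Proof. by rewrite divr_gt0 ?expR_gt0// sqrtr_gt0 mulr_gt0// pi_gt0. Qed.

Lemma is_derive_heat t x a p l : 0 < t + l * a ->
  let T := t + l * a in let X := x + l * p in
  is_derive l 1 (fun l => heat (t + l * a) (x + l * p))
    (heat T X * (X ^+ 2 / (2 * T ^+ 2) * a - X / T * p - a / (2 * T))).
Proof.
move=> T0 T X.
have T0' : T != 0 by rewrite gt_eqF.
have dT := der_affine l t a; have dX := der_affine l x p.
have dA : is_derive l 1 (fun l => - (x + l * p) ^+ 2 / (2 * (t + l * a)) - ln (t + l * a) / 2)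
   (X ^+ 2 / (2 * T ^+ 2) * a - X / T * p - a / (2 * T)).
  have H := der_add (der_mul (der_opp (der_sqr dX)) (der_inv (der_mul (der_cst 2 l) dT) _)) (der_opp (der_mul (der_ln dT T0) (der_cst 2^-1 l))).
  apply: (der_eq (H _)); rewrite -/T -/X; last by field.
  by rewrite mulf_neq0.
have H := der_mul (der_expR dA) (der_cst (Num.sqrt (2 * pi))^-1 l).
by apply: (der_eq H); rewrite /= -/T -/X /heat; ring.
Qed.

(** The derivative of ln (heat t x) in the direction (a, p), and below the
derivative of the former in the direction (b, r). *)
Definition heat_dlog (t x a p : R) := x ^+ 2 / (2 * t ^+ 2) * a - x / t * p - a / (2 * t).
Definition heat_dlog2 (t x a p b r : R) :=
  a * (x * r / t ^+ 2 - x ^+ 2 * b / t ^+ 3 + b / (2 * t ^+ 2))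
  - p * (r / t - x * b / t ^+ 2).

Lemma is_derive_heat_dlog t x a p b r m : 0 < t + m * b ->
  let T := t + m * b in let X := x + m * r in
  is_derive m 1 (fun m => heat_dlog (t + m * b) (x + m * r) a p) (heat_dlog2 T X a p b r).
Proof.
move=> T0 T X; have T0' : T != 0 by rewrite gt_eqF.
have dT := der_affine m t b; have dX := der_affine m x r.
have d2T := der_mul (der_cst 2 m) dT; have dT2 := der_sqr dT.
have d2T2 := der_mul (der_cst 2 m) dT2.
have H := der_add (der_add (der_mul (der_mul (der_sqr dX) (der_inv d2T2 _)) (der_cst a m))
  (der_opp (der_mul (der_mul dX (der_inv dT T0')) (der_cst p m))))
  (der_opp (der_mul (der_cst a m) (der_inv d2T _))).
apply: (der_eq (H _ _)); rewrite -/T -/X.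
- by rewrite mulf_neq0// sqrf_eq0.
- by rewrite mulf_neq0.
- by rewrite /heat_dlog2; field.
Qed.

(** Both variables move along the affine path t + l a + m b, x + l p + m r. The
second derivative in l and m of the exponential of a function g is that of g
plus the product of its two first derivatives, times the exponential. *)
Lemma heat_mixedE t x a p b r : 0 < t -> 0 <= a -> 0 <= b ->
  exists l m : R, [/\ 0 <= l <= 1, 0 <= m <= 1 &
    let T := t + l * a + m * b in let X := x + l * p + m * r in
    heat (t + a + b) (x + p + r) - heat (t + a) (x + p)
      - heat (t + b) (x + r) + heat t x
    = heat T X * (heat_dlog T X a p * heat_dlog T X b r + heat_dlog2 T X a p b r)].
Proof.
move=> t0 a0 b0.
pose F l m := heat (t + l * a + m * b) (x + l * p + m * r).
pose G l m := heat_dlog (t + l * a + m * b) (x + l * p + m * r).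
have pos l m : 0 <= l <= 1 -> 0 <= m <= 1 -> 0 < t + l * a + m * b.
  by move=> /andP[l0 _] /andP[m0 _]; rewrite -addrA ltr_wpDr// addr_ge0// mulr_ge0.
have [l m hl hm|l m hl hm|l [m [l01 m01 E]]] :=
   @mean_value2 R F (fun l m => F l m * G l m a p)
    (fun l m => F l m * (G l m a p * G l m b r + 
       heat_dlog2 (t + l * a + m * b) (x + l * p + m * r) a p b r)).
- rewrite /F /G.
  have H := @is_derive_heat (t + m * b) (x + m * r) a p l.
  rewrite /= ![_ + m * _ + _]addrAC in H.
  apply: (der_ext _ (H (pos _ _ hl hm))) => l'.
  by rewrite ![_ + m * _ + _]addrAC.
- rewrite /F /G.
  have H := is_derive_heat (x + l * p) r (pos _ _ hl hm).
  have H' := is_derive_heat_dlog (x + l * p) a p r (pos _ _ hl hm).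
  apply: (der_eq (der_mul H H')) => /=; rewrite -/(heat_dlog _ _ _ _); ring.
- exists l, m; split => //.
  by move: E; rewrite /F /G !mul1r !mul0r !addr0.
Qed.

Lemma heat_scaled_mixedE t x a p b r : 0 < t -> 0 <= a -> 0 <= b ->
  exists l m : R, [/\ 0 <= l <= 1, 0 <= m <= 1 &
    let T := t + l * a + m * b in let X := x + l * p + m * r in
    (t + a + b) * heat (t + a + b) (x + p + r) - (t + a) * heat (t + a) (x + p)
      - (t + b) * heat (t + b) (x + r) + t * heat t x
    = heat T X * ((a + T * heat_dlog T X a p) * heat_dlog T X b r + b * heat_dlog T X a p
                   + T * heat_dlog2 T X a p b r)].
Proof.
move=> t0 a0 b0.
pose F l m := (t + l * a + m * b) * heat (t + l * a + m * b) (x + l * p + m * r).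
pose H l m := heat (t + l * a + m * b) (x + l * p + m * r).
pose G l m := heat_dlog (t + l * a + m * b) (x + l * p + m * r).
have pos l m : 0 <= l <= 1 -> 0 <= m <= 1 -> 0 < t + l * a + m * b.
  by move=> /andP[l0 _] /andP[m0 _]; rewrite -addrA ltr_wpDr// addr_ge0// mulr_ge0.
have [l m hl hm|l m hl hm|l [m [l01 m01 E]]] :=
   @mean_value2 R F (fun l m => H l m * (a + (t + l * a + m * b) * G l m a p))
    (fun l m => H l m * ((a + (t + l * a + m * b) * G l m a p) * G l m b r
       + b * G l m a p + (t + l * a + m * b) *
       heat_dlog2 (t + l * a + m * b) (x + l * p + m * r) a p b r)).
- rewrite /F /G.
  have K := @is_derive_heat (t + m * b) (x + m * r) a p l.
  rewrite /= ![_ + m * _ + _]addrAC in K.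
  have K' := der_mul (der_affine l (t + m * b) a) (K (pos _ _ hl hm)).
  apply: (der_ext _ (der_eq K' _)) => [l'|].
    by rewrite ![_ + m * _ + _]addrAC.
  by rewrite ![_ + m * _ + _]addrAC /H /heat_dlog; ring.
- rewrite /F /G /H.
  have K := is_derive_heat (x + l * p) r (pos _ _ hl hm).
  have K' := is_derive_heat_dlog (x + l * p) a p r (pos _ _ hl hm).
  apply: (der_eq (der_mul K (der_add (der_cst a m) (der_mul (der_affine m (t + l * a) b) K')))) => /=.
  rewrite -/(heat_dlog _ _ _ _); ring.
- exists l, m; split => //.
  by move: E; rewrite /F /H /G !mul1r !mul0r !addr0.
Qed.

Lemma heat_diffE t x a p : 0 < t -> 0 <= a ->
  exists2 l : R, 0 <= l <= 1 &
    let T := t + l * a in let X := x + l * p in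
    heat (t + a) (x + p) - heat t x = heat T X * heat_dlog T X a p.
Proof.
move=> t0 a0.
have pos l : 0 <= l <= 1 -> 0 < t + l * a.
  by move=> /andP[l0 _]; rewrite ltr_wpDr// mulr_ge0.
have [l l01 E] := mean_value (@ler01 R) (fun l hl => is_derive_heat x p (pos l hl)).
by exists l => //=; move: E; rewrite !mul1r !mul0r !addr0 subr0 mulr1.
Qed.

Lemma heat_scaled_diffE t x a p : 0 < t -> 0 <= a ->
  exists2 l : R, 0 <= l <= 1 &
    let T := t + l * a in let X := x + l * p in
    (t + a) * heat (t + a) (x + p) - t * heat t x = heat T X * (a + T * heat_dlog T X a p).
Proof.
move=> t0 a0.
have pos l : 0 <= l <= 1 -> 0 < t + l * a.
  by move=> /andP[l0 _]; rewrite ltr_wpDr// mulr_ge0.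
have [l l01 E] := mean_value (@ler01 R) (fun l hl =>
   der_mul (der_affine l t a) (is_derive_heat x p (pos l hl))).
exists l => //=; move: E; rewrite !mul1r !mul0r !addr0 subr0 mulr1 => ->.
by rewrite /heat_dlog; ring.
Qed.
End heat.

Section bounds.
Context {R : realType}.
Implicit Types t x y z L : R.

Lemma heat_le (t T x y c : R) : 0 <= c -> 0 < t -> 0 < T ->
  - x ^+ 2 / (2 * T) - ln T / 2 <= c - y ^+ 2 / (2 * t) - ln t / 2 ->
  heat T x <= expR c * heat t y.
Proof.
move=> c0 t0 T0 H; rewrite /heat mulrA ler_pM2r; last first.
  by rewrite invr_gt0 sqrtr_gt0 mulr_gt0// pi_gt0.
rewrite -expRD ler_expR; apply: le_trans H _.
by rewrite le_eqVlt; apply/orP; left; apply/eqP; ring.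
Qed.

Lemma sqr1D_le_expR (v : R) : 0 <= v -> (1 + v) ^+ 2 <= 64 * expR (v / 4).
Proof.
move=> v0; have H := expR_ge1Dx (v / 8).
have -> : expR (v / 4) = expR (v / 8) ^+ 2 by rewrite -expRM_natl; congr expR; field.
rewrite (_ : 64 = 8 ^+ 2 :> R); last by ring.
rewrite -exprMn ler_pXn2r// ?nnegrE; [lra|lra|].
by rewrite mulr_ge0// expR_ge0.
Qed.

Lemma ln_mul8 t : 0 < t -> ln (8 * t) <= 2 * ln 3 + ln t.
Proof.
move=> t0; rewrite lnM ?posrE//.
rewrite lerD2r (_ : 2 * ln 3 = ln (3 ^+ 2)); last by rewrite lnXn; [ring|lra].
by rewrite ler_ln ?posrE; lra.
Qed.

(** All kernels met over a short rectangle, multiplied by polynomials in x^2/T,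
are dominated by a single wider Gaussian: half of the exponent absorbs the
polynomial, and as z = O(T) the shift costs only a constant factor. *)
Lemma heat_poly_le t T y z L : 0 < t -> t <= T -> T <= 2 * t -> T <= 1 ->
  0 <= L -> `|z| <= L * T ->
  heat T (y + z) * (1 + (y + z) ^+ 2 / T) ^+ 2 <= 192 * expR (L ^+ 2) * heat (8 * t) y.
Proof.
move=> t0 tT Tt T1 L0 zL; have T0 : 0 < T by exact: lt_le_trans tT.
set v := (y + z) ^+ 2 / T; have v0 : 0 <= v by rewrite divr_ge0 ?sqr_ge0 ?ltW.
have h0 := heat_gt0 T (y + z).
apply: (@le_trans _ _ (heat T (y + z) * (64 * expR (v / 4)))).
  by rewrite ler_pM2l// sqr1D_le_expR.
have E : heat T (y + z) * expR (v / 4) = 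
    expR (- ((y + z) ^+ 2) / (4 * T) - ln T / 2) / Num.sqrt (2 * pi).
  rewrite /heat mulrAC -expRD; congr (expR _ / _); rewrite /v; field.
  by rewrite gt_eqF.
rewrite mulrCA E (_ : 192 = 64 * expR (ln 3)); last by rewrite lnK ?posrE; lra.
rewrite -!mulrA ler_pM2l; last lra.
rewrite /heat !mulrA ler_pM2r; last first.
  by rewrite invr_gt0 sqrtr_gt0 mulr_gt0// pi_gt0.
rewrite -!expRD ler_expR.
have l8 := ln_mul8 t0.
have lT : ln t <= ln T by rewrite ler_ln ?posrE.
have z2 : z ^+ 2 <= (L * T) ^+ 2.
  by rewrite -(@real_normK _ z) ?num_real// ler_pXn2r ?nnegrE// mulr_ge0// ltW.
have q : y ^+ 2 / 2 - z ^+ 2 <= (y + z) ^+ 2.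
  have := sqr_ge0 (y / 2 + z); have := sqr_ge0 y; nra.
have s1 : z ^+ 2 / (4 * T) <= L ^+ 2.
  rewrite ler_pdivrMr; last lra.
  apply: le_trans z2 _; rewrite exprMn ler_wpM2l ?sqr_ge0//; nra.
have s2 : y ^+ 2 / (2 * (8 * t)) <= (y ^+ 2 / 2) / (4 * T).
  rewrite -mulrA ler_wpM2l ?sqr_ge0// -invfM lef_pV2 ?posrE; lra.
have s3 : (y ^+ 2 / 2 - z ^+ 2) / (4 * T) <= (y + z) ^+ 2 / (4 * T).
  by rewrite ler_pM2r// invr_gt0; lra.
rewrite mulrBl in s3; rewrite !mulNr; lra.
Qed.

(** Widening the Gaussian absorbs y^2, since v <= e^v. *)
Lemma heat_sqr_le t y : 0 < t -> y ^+ 2 * heat (8 * t) y <= 64 * t * heat (16 * t) y.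
Proof.
move=> t0; have t0' : t != 0 by rewrite gt_eqF.
have h0 := heat_gt0 (16 * t) y.
have H : y ^+ 2 <= 32 * t * expR (y ^+ 2 / (32 * t)).
  have K := expR_ge1Dx (y ^+ 2 / (32 * t)).
  rewrite mulrC -ler_pdivrMr; lra.
apply: (@le_trans _ _ (32 * t * expR (y ^+ 2 / (32 * t)) * heat (8 * t) y)).
  by rewrite ler_pM2r ?heat_gt0.
rewrite -mulrA (_ : 64 * t = 32 * t * 2); last by ring.
rewrite -!mulrA !ler_pM2l//.
rewrite /heat !mulrA ler_pM2r; last first.
  by rewrite invr_gt0 sqrtr_gt0 mulr_gt0// pi_gt0.
have e2 : 2 = expR (ln 2) :> R by rewrite lnK ?posrE; lra.
rewrite [X in _ <= X * _]e2.
rewrite -!expRD ler_expR.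
have -> : 16 * t = 2 * (8 * t) by ring.
rewrite [in leRHS]lnM ?posrE//; last lra.
have l2 : 0 <= ln (2 : R) by rewrite ln_ge0//; lra.
have -> : y * y / (32 * t) = y ^+ 2 / t / 32 by field.
have -> : - y ^+ 2 / (2 * 8 * t) = - (y ^+ 2 / t) / 16 by field.
have -> : - y ^+ 2 / (2 * 16 * t) = - (y ^+ 2 / t) / 32 by field.
lra.
Qed.

Lemma heat8_le16 t y : 0 < t -> heat (8 * t) y <= 2 * heat (16 * t) y.
Proof.
move=> t0; rewrite (_ : 2 = expR (ln 2)); last by rewrite lnK ?posrE; lra.
apply: heat_le; [|lra|lra|].
  by rewrite ln_ge0//; lra.
rewrite (_ : 16 * t = 2 * (8 * t)); last by ring.
rewrite [in leRHS]lnM ?posrE//; last lra.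
have l2 : 0 <= ln (2 : R) by rewrite ln_ge0//; lra.
have : y ^+ 2 / (2 * (2 * (8 * t))) <= y ^+ 2 / (2 * (8 * t)).
  by rewrite ler_wpM2l ?sqr_ge0// lef_pV2 ?posrE; lra.
rewrite mulNr; lra.
Qed.

(** The mean inequality |x| <= (T + x^2/T) / 2 turns odd powers of x into powers
of the scale-invariant quantity x^2/T. *)
Lemma normr_amgm T x : 0 < T -> T <= 1 -> `|x| / T <= (1 + x ^+ 2 / T) / (2 * T).
Proof.
move=> T0 T1; rewrite ler_pdivrMr//.
have -> : (1 + x ^+ 2 / T) / (2 * T) * T = (1 + x ^+ 2 / T) / 2 by field; rewrite gt_eqF.
have : `|x| <= (T + x ^+ 2 / T) / 2.
  rewrite -(@ler_pM2r _ T)//.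
  have -> : (T + x ^+ 2 / T) / 2 * T = (T ^+ 2 + x ^+ 2) / 2 by field; rewrite gt_eqF.
  rewrite -(@real_normK _ x) ?num_real//; have := sqr_ge0 (`|x| - T); nra.
lra.
Qed.

(** A direction with |p| <= L a is one in which x moves at speed at most L: the
diffusive scaling then makes each derivative cost a factor 1/T. *)
Lemma heat_dlog_le T x a p L : 0 < T -> T <= 1 -> 0 <= L -> 0 <= a -> `|p| <= L * a ->
  `|heat_dlog T x a p| <= (1 + L) * a / T * (1 + x ^+ 2 / T).
Proof.
move=> T0 T1 L0 a0 pL; set v := x ^+ 2 / T.
have T0' : T != 0 by rewrite gt_eqF.
have v0 : 0 <= v by rewrite divr_ge0 ?sqr_ge0 ?ltW.
have iT : 0 < T^-1 by rewrite invr_gt0.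
have H := normr_amgm x T0 T1; rewrite -/v in H.
have -> : heat_dlog T x a p = (v / 2 * a - x * p - a / 2) / T.
  by rewrite /heat_dlog /v; field.
rewrite normrM (ger0_norm (ltW iT)) -[leRHS]mulrAC ler_pM2r//.
have xp : `|x * p| <= (1 + v) / 2 * (L * a).
  rewrite normrM ler_pM// -(@ler_pM2r _ T^-1)//; apply: le_trans H _.
  by rewrite le_eqVlt; apply/orP; left; apply/eqP; field.
have : `|v / 2 * a - x * p - a / 2| <= v / 2 * a + `|x * p| + a / 2.
  apply: le_trans (ler_normB _ _) _; rewrite (@ger0_norm _ (a / 2)); last lra.
  rewrite lerD2r; apply: le_trans (ler_normB _ _) _; rewrite ger0_norm//; nra.
have La : 0 <= L * a by rewrite mulr_ge0.
nra.
Qed.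

Lemma heat_dlog2_le T x a p b r L : 0 < T -> T <= 1 -> 0 <= L -> 0 <= a -> 0 <= b ->
  `|p| <= L * a -> `|r| <= L * b ->
  `|heat_dlog2 T x a p b r| <= (1 + L) ^+ 2 * a * b / T ^+ 2 * (1 + x ^+ 2 / T).
Proof.
move=> T0 T1 L0 a0 b0 pL rL; set v := x ^+ 2 / T.
have T0' : T != 0 by rewrite gt_eqF.
have v0 : 0 <= v by rewrite divr_ge0 ?sqr_ge0 ?ltW.
have iT : 0 < T^-1 by rewrite invr_gt0.
have iT2 : 0 < (T ^+ 2)^-1 by rewrite invr_gt0 exprn_gt0.
have H := normr_amgm x T0 T1; rewrite -/v in H.
have -> : heat_dlog2 T x a p b r = (a * (x * r) - v * (a * b) + a * b / 2 - p * r * T + b * (x * p)) / T ^+ 2.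
  by rewrite /heat_dlog2 /v; field.
rewrite normrM (ger0_norm (ltW iT2)) -[leRHS]mulrAC ler_pM2r//.
have xq q c : 0 <= c -> `|q| <= L * c -> `|x * q| <= (1 + v) / 2 * (L * c).
  move=> c0 qL; rewrite normrM ler_pM// -(@ler_pM2r _ T^-1)//; apply: le_trans H _.
  by rewrite le_eqVlt; apply/orP; left; apply/eqP; field.
have xp := xq _ _ a0 pL; have xr := xq _ _ b0 rL.
have ab : 0 <= a * b by rewrite mulr_ge0.
have e1 : `|a * (x * r)| <= (1 + v) / 2 * L * (a * b).
  by rewrite normrM (ger0_norm a0); apply: (le_trans (ler_wpM2l a0 xr)); rewrite le_eqVlt; apply/orP; left; apply/eqP; ring.
have e2 : `|b * (x * p)| <= (1 + v) / 2 * L * (a * b).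
  by rewrite normrM (ger0_norm b0); apply: (le_trans (ler_wpM2l b0 xp)); rewrite le_eqVlt; apply/orP; left; apply/eqP; ring.
have e3 : `|p * r * T| <= L ^+ 2 * (a * b).
  rewrite normrM (ger0_norm (ltW T0)) normrM; apply: (@le_trans _ _ (`|p| * `|r|)).
    by rewrite ler_piMr// mulr_ge0.
  by rewrite (_ : _ * (a * b) = L * a * (L * b)); [rewrite ler_pM|ring].
have e4 : 0 <= v * (a * b) by rewrite mulr_ge0.
have : `|a * (x * r) - v * (a * b) + a * b / 2 - p * r * T + b * (x * p)| <=
   `|a * (x * r)| + v * (a * b) + a * b / 2 + `|p * r * T| + `|b * (x * p)|.
  rewrite (le_trans (ler_normD _ _))// lerD2r (le_trans (ler_normB _ _))// lerD2r.
  rewrite (le_trans (ler_normD _ _))// (@ger0_norm _ (a * b / 2)) ?lerD2r; last lra.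
  by rewrite (le_trans (ler_normB _ _))// (ger0_norm e4).
have : 0 <= L * (a * b) by rewrite mulr_ge0.
have : 0 <= L ^+ 2 * (a * b) by rewrite mulr_ge0 ?sqr_ge0.
have := mulr_ge0 (mulr_ge0 v0 L0) ab.
have := mulr_ge0 (mulr_ge0 v0 (sqr_ge0 L)) ab.
nra.
Qed.
End bounds.

(** * The explicit term t * heat t x *)

Section main_term.
Context {R : realType}.
Implicit Types t x y z L : R.

(** The size of the second derivative of a square root. *)
Definition pow_m32 (t : R) : R := t `^ (- (3 / 2)).
Notation kappa := (Num.sqrt (2 * pi : R))^-1.

Lemma kappa_gt0 : 0 < kappa.
Proof. by rewrite invr_gt0 sqrtr_gt0 mulr_gt0// pi_gt0. Qed.

Lemma kappa_le1 : kappa <= 1.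
Proof.
have p2 : 1 <= 2 * pi :> R by have := pi_ge2 R; lra.
rewrite invf_le1; last by rewrite sqrtr_gt0; apply: lt_le_trans p2.
by rewrite -[leLHS]sqrtr1 ler_wsqrtr.
Qed.

Lemma pow_m32E t : 0 < t -> pow_m32 t = expR (- ln t / 2) / t.
Proof.
move=> t0; rewrite /pow_m32 /powR gt_eqF//.
rewrite (_ : t^-1 = expR (- ln t)); last by rewrite expRN lnK.
by rewrite -expRD; congr expR; field.
Qed.

Lemma pow_m32_gt0 t : 0 < t -> 0 < pow_m32 t.
Proof. by move=> t0; rewrite powR_gt0. Qed.

Lemma pow_m32_anti s t : 0 < s -> s <= t -> pow_m32 t <= pow_m32 s.
Proof.
move=> s0 st; have t0 := lt_le_trans s0 st.
rewrite /pow_m32 !powRN lef_pV2 ?posrE ?powR_gt0//.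
apply: ge0_ler_powR; [lra| | |exact: st]; rewrite nnegrE ltW//.
Qed.

Lemma inv_le_pow_m32 t d : 0 < t -> t <= d -> t^-1 <= Num.sqrt d * pow_m32 t.
Proof.
move=> t0 td; rewrite pow_m32E// mulrA; apply: ler_peMl; first by rewrite invr_ge0 ltW.
have -> : expR (- ln t / 2) = (Num.sqrt t)^-1.
  by rewrite mulNr expRN -powR12_sqrt ?ltW// /powR gt_eqF// mulrC.
by rewrite ler_pdivlMr ?sqrtr_gt0// mul1r ler_wsqrtr.
Qed.

Lemma heat_div_le t x : 0 < t -> heat t x / t <= pow_m32 t.
Proof.
move=> t0; rewrite pow_m32E// ler_pM2r ?invr_gt0// /heat.
apply: (@le_trans _ _ (expR (- ln t / 2) * kappa)); last first.
  by rewrite ler_piMr ?expR_ge0// kappa_le1.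
rewrite ler_pM2r ?kappa_gt0// ler_expR !mulNr.
have : 0 <= x ^+ 2 / (2 * t) by rewrite divr_ge0 ?sqr_ge0// mulr_ge0// ltW.
lra.
Qed.

(** With |x| <= L t the Gaussian factor stays away from 0, hence [heat] / t is of
the exact order t^(-3/2). *)
Lemma heat_div_ge t x L : 0 < t -> t <= 1 -> `|x| <= L * t ->
  kappa * expR (- L ^+ 2) * pow_m32 t <= heat t x / t.
Proof.
move=> t0 t1 xL; rewrite pow_m32E// mulrA ler_pM2r ?invr_gt0// /heat.
rewrite -mulrA mulrC ler_pM2r ?kappa_gt0// -expRD ler_expR !mulNr.
have L0 : 0 <= L * t by apply: le_trans xL.
have x2 : x ^+ 2 <= (L * t) ^+ 2.
  by rewrite -(@real_normK _ x) ?num_real// ler_pXn2r ?nnegrE.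
have : x ^+ 2 / (2 * t) <= L ^+ 2.
  rewrite ler_pdivrMr ?mulr_gt0//; apply: (le_trans x2).
  by rewrite exprMn ler_wpM2l ?sqr_ge0//; nra.
lra.
Qed.

Lemma normM_le (x y c d : R) : `|x| <= c -> `|y| <= d -> - (c * d) <= x * y <= c * d.
Proof. by move=> xc yd; rewrite -ler_norml normrM ler_pM. Qed.

(** With x = w T, |w| <= L, the terms of order 1/T combine into - a b / (4 T): they
are those of the second derivative of sqrt T, and what remains is bounded. *)
Lemma main_factor_le T x a p b r L : 0 < T -> T <= 1 -> 0 <= L -> 0 <= a -> 0 <= b ->
  `|x| <= L * T -> `|p| <= L * a -> `|r| <= L * b ->
  `|(a + T * heat_dlog T x a p) * heat_dlog T x b r + b * heat_dlog T x a p + T * heat_dlog2 T x a p b r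
    + a * b / (4 * T)| <= (6 * L ^+ 2 + 4 * L ^+ 4) * (a * b).
Proof.
move=> T0 T1 L0 a0 b0 xL pL rL; have T0' : T != 0 by rewrite gt_eqF.
pose w := x / T.
have xE : x = w * T by rewrite /w divfK.
have wL : `|w| <= L.
  by rewrite /w normrM normfV (ger0_norm (ltW T0)) ler_pdivrMr.
have ww : - (L * L) <= w * w <= L * L by exact: normM_le.
pose al := w * w * a / 2 - w * p; pose be := w * w * b / 2 - w * r.
have nal : `|al| <= 2 * L ^+ 2 * a.
  have wp := normM_le wL pL.
  have w2 : 0 <= w * w * a <= L * L * a.
    by rewrite mulr_ge0 ?ler_wpM2r// -?expr2 ?sqr_ge0//; case/andP: ww.
  have := w2; have := wp; rewrite /al ler_norml => /andP[? ?] /andP[? ?].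
  have : 0 <= L * L * a by rewrite !mulr_ge0.
  by move=> ?; apply/andP; split; rewrite ?expr2; lra.
have nbe : `|be| <= 2 * L ^+ 2 * b.
  have wp := normM_le wL rL.
  have w2 : 0 <= w * w * b <= L * L * b.
    by rewrite mulr_ge0 ?ler_wpM2r// -?expr2 ?sqr_ge0//; case/andP: ww.
  have := w2; have := wp; rewrite /be ler_norml => /andP[? ?] /andP[? ?].
  have : 0 <= L * L * b by rewrite !mulr_ge0.
  by move=> ?; apply/andP; split; rewrite ?expr2; lra.
(* In terms of w, al and be are the parts of the logarithmic derivatives that are
   bounded as T tends to 0. *)
have -> : (a + T * heat_dlog T x a p) * heat_dlog T x b r + b * heat_dlog T x a p + T * heat_dlog2 T x a p b r
    + a * b / (4 * T) = a * be / 2 + T * (al * be) + b * al / 2 + a * (w * r)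
      - (w * w) * (a * b) - p * r + b * (p * w).
  by rewrite /al /be /heat_dlog /heat_dlog2 xE; field.
have ab0 : 0 <= a * b by exact: mulr_ge0.
have na : `|a| <= a by rewrite ger0_norm.
have nb : `|b| <= b by rewrite ger0_norm.
have nT : `|T| <= 1 by rewrite (ger0_norm (ltW T0)).
have nn x' c d : - (c * d) <= x' <= c * d -> `|x'| <= c * d by rewrite ler_norml.
have /andP[? ?] := normM_le na nbe.
have /andP[? ?] := normM_le nb nal.
have /andP[? ?] := normM_le nT (nn _ _ _ (normM_le nal nbe)).
have /andP[? ?] := normM_le na (nn _ _ _ (normM_le wL rL)).
have /andP[? ?] := normM_le nb (nn _ _ _ (normM_le pL wL)).
have /andP[? ?] := normM_le pL rL.
have : 0 <= w * w * (a * b) <= L * L * (a * b).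
  by rewrite mulr_ge0 ?ler_wpM2r// -?expr2 ?sqr_ge0//; case/andP: ww.
move=> /andP[? ?]; rewrite ler_norml; apply/andP; split; lra.
Qed.

(** The source of the order tau^(-3/2) and of the negative sign. *)
Lemma heat_scaled_mixed_le t x a p b r L : 0 < t -> 0 <= a -> 0 <= b -> t + a + b <= 1 ->
  0 <= L -> `|x| <= L * t -> `|p| <= L * a -> `|r| <= L * b ->
  exists T X : R, [/\ t <= T, T <= t + a + b, `|X| <= L * T &
    `|(t + a + b) * heat (t + a + b) (x + p + r) - (t + a) * heat (t + a) (x + p)
      - (t + b) * heat (t + b) (x + r) + t * heat t x
      + heat T X / T * (a * b / 4)| <= heat T X * ((6 * L ^+ 2 + 4 * L ^+ 4) * (a * b))].
Proof.
move=> t0 a0 b0 t1 L0 xL pL rL.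
have [l [m [/andP[l0 l1] /andP[m0 m1] /= ->]]] := heat_scaled_mixedE x p r t0 a0 b0.
set T := t + l * a + m * b; set X := x + l * p + m * r.
have la0 : 0 <= l * a by rewrite mulr_ge0.
have mb0 : 0 <= m * b by rewrite mulr_ge0.
have la1 : l * a <= a by rewrite ler_piMl.
have mb1 : m * b <= b by rewrite ler_piMl.
have tT : t <= T by rewrite /T; lra.
have Tt : T <= t + a + b by rewrite /T; lra.
have T0 : 0 < T by apply: lt_le_trans tT.
have XL : `|X| <= L * T.
  rewrite /X /T !mulrDr.
  apply: le_trans (ler_normD _ _) _; apply: lerD; last first.
    by rewrite normrM (ger0_norm m0) mulrCA ler_wpM2l.
  apply: le_trans (ler_normD _ _) _; apply: lerD => //.
  by rewrite normrM (ger0_norm l0) mulrCA ler_wpM2l.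
exists T, X; split => //.
have -> : heat T X / T * (a * b / 4) = heat T X * (a * b / (4 * T)).
  by field; rewrite gt_eqF.
rewrite -mulrDr normrM ger0_norm; last exact/ltW/heat_gt0.
rewrite ler_pM2l ?heat_gt0//; apply: main_factor_le => //; exact: le_trans t1.
Qed.

Lemma heat_scaled_diff_le t x b r L : 0 < t -> 0 <= b -> t + b <= 1 ->
  0 <= L -> `|x| <= L * t -> `|r| <= L * b ->
  `|(t + b) * heat (t + b) (x + r) - t * heat t x|
     <= (1 + (1 + L) * (1 + L ^+ 2)) * b / t.
Proof.
move=> t0 b0 t1 L0 xL rL.
have [m /andP[m0 m1] /= ->] := heat_scaled_diffE x r t0 b0.
set T := t + m * b; set X := x + m * r.
have mb0 : 0 <= m * b by rewrite mulr_ge0.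
have mb1 : m * b <= b by rewrite ler_piMl.
have tT : t <= T by rewrite /T; lra.
have Tt : T <= t + b by rewrite /T; lra.
have T0 : 0 < T by apply: lt_le_trans tT.
have T1 : T <= 1 by apply: le_trans t1.
have XL : `|X| <= L * T.
  rewrite /X /T !mulrDr.
  apply: le_trans (ler_normD _ _) _; apply: lerD => //.
  by rewrite normrM (ger0_norm m0) mulrCA ler_wpM2l.
have h0 := heat_gt0 T X.
have hT : heat T X <= t^-1.
  apply: (@le_trans _ _ T^-1); last by rewrite lef_pV2.
  rewrite (_ : T^-1 = expR (- ln T)); last by rewrite expRN lnK.
  apply: (@le_trans _ _ (expR (- ln T) * kappa)); last first.
    by rewrite ler_piMr ?expR_ge0// kappa_le1.
  rewrite /heat ler_pM2r ?kappa_gt0// ler_expR !mulNr.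
  have : 0 <= X ^+ 2 / (2 * T) by rewrite divr_ge0 ?sqr_ge0// mulr_ge0// ltW.
  have : ln T <= 0 by rewrite ln_le0.
  lra.
have vL : X ^+ 2 / T <= L ^+ 2.
  rewrite ler_pdivrMr// -(@real_normK _ X) ?num_real//.
  apply: (@le_trans _ _ ((L * T) ^+ 2)).
    by rewrite ler_pXn2r ?nnegrE// mulr_ge0// ltW.
  by rewrite exprMn ler_wpM2l ?sqr_ge0//; nra.
have HA := heat_dlog_le X T0 T1 L0 b0 rL.
have L1 : 0 <= 1 + L by rewrite addr_ge0.
have HT : T * `|heat_dlog T X b r| <= (1 + L) * (1 + L ^+ 2) * b.
  apply: (le_trans (ler_wpM2l (ltW T0) HA)).
  have -> : T * ((1 + L) * b / T * (1 + X ^+ 2 / T)) = (1 + L) * b * (1 + X ^+ 2 / T).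
    by field; rewrite gt_eqF.
  rewrite mulrAC; apply: ler_wpM2r => //; apply: ler_wpM2l => //.
  by rewrite lerD2l.
rewrite normrM (ger0_norm (ltW h0)) mulrC.
apply: ler_pM => //.
  exact: ltW.
apply: le_trans (ler_normD _ _) _.
rewrite (ger0_norm b0) normrM (ger0_norm (ltW T0)).
have -> : (1 + (1 + L) * (1 + L ^+ 2)) * b = b + (1 + L) * (1 + L ^+ 2) * b by ring.
by rewrite lerD2l.
Qed.
End main_term.

(** * Integrals against the Gaussian kernel *)

Section integrals.
Context {R : realType}.
Implicit Types t x y z L : R.
Notation mu := (@lebesgue_measure R).

Lemma measurable_heat t z : 0 < t -> measurable_fun setT (fun y => heat t (y + z)).
Proof.
move=> t0; rewrite (_ : (fun _ => _) = normal_pdf (- z) (Num.sqrt t)).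
  exact: measurable_normal_pdf.
by apply/funext => y; rewrite heat_normal_pdf// opprK.
Qed.

Lemma measurable_heat0 t : 0 < t -> measurable_fun setT (heat t).
Proof.
by move=> /(measurable_heat 0); under eq_fun do rewrite addr0.
Qed.

Lemma continuous_heat t : 0 < t -> continuous (heat t).
Proof.
move=> t0; rewrite (_ : heat t = normal_pdf 0 (Num.sqrt t)).
  by apply: continuous_normal_pdf; rewrite gt_eqF// sqrtr_gt0.
by apply/funext => y; rewrite heat_normal_pdf// subr0.
Qed.

Lemma integral_heat t : 0 < t -> (\int[mu]_y (heat t y)%:E = 1)%E.
Proof.
move=> t0; rewrite -(integral_normal_pdf 0 (Num.sqrt t)).
by apply: eq_integral => y _; rewrite heat_normal_pdf// subr0.
Qed.

Lemma integrable_heat t : 0 < t -> mu.-integrable setT (EFin \o heat t).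
Proof.
move=> t0; rewrite (_ : EFin \o _ = EFin \o (normal_pdf 0 (Num.sqrt t))).
  exact: integrable_normal_pdf.
by apply/funext => y /=; rewrite heat_normal_pdf// subr0.
Qed.

(** Every remainder is estimated by domination by a multiple of a Gaussian
density, whose integral is 1. *)
Lemma integrable_heat_dom (h : R -> R) c t : 0 < t -> measurable_fun setT h ->
  (forall y, `|h y| <= c * heat t y) -> mu.-integrable setT (EFin \o h).
Proof.
move=> t0 mh hle.
apply: (le_integrable _ _ _ (integrableZl measurableT c (integrable_heat t0))) => //.
  exact/measurable_EFinP.
move=> y _ /=; rewrite lee_fin (le_trans (hle y))//.
exact: ler_norm.
Qed.

Lemma Rintegral_heat_le (h : R -> R) c t : 0 < t -> measurable_fun setT h ->
  (forall y, `|h y| <= c * heat t y) -> `| \int[mu]_y h y | <= c.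
Proof.
move=> t0 mh hle; have ih := integrable_heat_dom t0 mh hle.
apply: le_trans (le_normr_Rintegral measurableT ih) _.
have -> : c = \int[mu]_y (c * heat t y).
  rewrite RintegralZl//; last exact: integrable_heat.
  by rewrite /Rintegral integral_heat// mulr1.
apply: le_Rintegral => //.
- exact: integrable_abse ih.
- exact: integrableZl (integrable_heat t0).
Qed.

Let sqrD_heat_le t y : 0 < t ->
  (y ^+ 2 + t) * heat (8 * t) y <= 66 * t * heat (16 * t) y.
Proof.
move=> t0; have := heat_sqr_le y t0; have := heat8_le16 y t0; have := t0.
have := heat_gt0 (8 * t) y; have := heat_gt0 (16 * t) y; nra.
Qed.

Lemma integrable_quadratic_heat (f k : R -> R) c e t : 0 < t -> 0 <= c -> 0 <= e ->
  measurable_fun setT f -> measurable_fun setT k ->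
  (forall y, `|f y| <= c * (y ^+ 2 + t)) ->
  (forall y, 0 <= k y <= e * heat (8 * t) y) ->
  mu.-integrable setT (EFin \o (fun y => f y * k y)).
Proof.
move=> t0 c0 e0 mf mk hf hk.
have t16 : 0 < 16 * t by rewrite mulr_gt0.
apply: (@integrable_heat_dom _ (c * e * (66 * t)) _ t16).
  exact: measurable_funM.
move=> y; have /andP[k0 ke] := hk y.
rewrite normrM (ger0_norm k0); apply: le_trans (ler_pM _ _ (hf y) ke) _ => //.
have -> : c * (y ^+ 2 + t) * (e * heat (8 * t) y) =
  c * e * ((y ^+ 2 + t) * heat (8 * t) y) by ring.
rewrite -[leRHS]mulrA; apply: ler_wpM2l; last exact: sqrD_heat_le.
exact: mulr_ge0.
Qed.

(** The kernels k00, k10, k01, k11 are those at the corners of a rectangle: the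
first index refers to the later time and the second one to the earlier time. *)
Section mixed.
Variables (t a b z p r L c : R).
Hypotheses (t0 : 0 < t) (a0 : 0 <= a) (b0 : 0 <= b) (abt : a + b <= t)
  (t1 : 2 * t <= 1) (L0 : 0 <= L) (c0 : 0 <= c)
  (zL : `|z| <= L * t) (pL : `|p| <= L * a) (rL : `|r| <= L * b).

Let E := 192 * expR (L ^+ 2).
Definition mixed_const := 2 * (1 + L) ^+ 2 * E.
Let D := mixed_const.

Let E0 : 0 < E. Proof. by rewrite mulr_gt0// expR_gt0. Qed.
Let D0 : 0 < D.
Proof.
by rewrite /D /mixed_const; apply: mulr_gt0 => //; apply: mulr_gt0 => //; apply: exprn_gt0; have := L0; lra.
Qed.
Let ED : E <= D.
Proof.
rewrite /D /mixed_const ler_peMl ?(ltW E0)//; have := L0; nra.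
Qed.

Let zT l m : 0 <= l <= 1 -> 0 <= m <= 1 ->
  [/\ 0 < t + l * a + m * b, t <= t + l * a + m * b, t + l * a + m * b <= 2 * t,
    t + l * a + m * b <= 1 &
  `|z + l * p + m * r| <= L * (t + l * a + m * b)].
Proof.
move=> /andP[l0 l1] /andP[m0 m1].
have la0 : 0 <= l * a by rewrite mulr_ge0.
have mb0 : 0 <= m * b by rewrite mulr_ge0.
have la1 : l * a <= a by rewrite ler_piMl.
have mb1 : m * b <= b by rewrite ler_piMl.
split; [have := t0; lra|lra|have := abt; lra|have := abt; have := t1; lra|].
rewrite !mulrDr.
apply: le_trans (ler_normD _ _) _; apply: lerD; last first.
  by rewrite normrM (ger0_norm m0) mulrCA ler_wpM2l.
apply: le_trans (ler_normD _ _) _; apply: lerD => //.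
by rewrite normrM (ger0_norm l0) mulrCA ler_wpM2l.
Qed.

Let heat_pol l m y : 0 <= l <= 1 -> 0 <= m <= 1 ->
  heat (t + l * a + m * b) (y + z + l * p + m * r) *
    (1 + (y + z + l * p + m * r) ^+ 2 / (t + l * a + m * b)) ^+ 2 
  <= E * heat (8 * t) y.
Proof.
move=> /zT H /H[T0 T1 T2 T3 T4].
have -> : y + z + l * p + m * r = y + (z + l * p + m * r) by rewrite !addrA.
exact: (heat_poly_le y t0 T1 T2 T3 L0 T4).
Qed.

Let heat_k_le l m y : 0 <= l <= 1 -> 0 <= m <= 1 ->
  heat (t + l * a + m * b) (y + z + l * p + m * r) <= E * heat (8 * t) y.
Proof.
move=> l01 m01; apply: le_trans (heat_pol y l01 m01).
apply: ler_peMr; first by rewrite ltW ?heat_gt0.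
apply: exprn_ege1; rewrite lerDl; apply: divr_ge0; first exact: sqr_ge0.
by have [/ltW] := zT l01 m01.
Qed.

Let i0 : 0 <= (0 : R) <= 1. Proof. by rewrite lexx ler01. Qed.
Let i1 : 0 <= (1 : R) <= 1. Proof. by rewrite lexx ler01. Qed.

Let k00 y := heat t (y + z).
Let k10 y := heat (t + a) (y + z + p).
Let k01 y := heat (t + b) (y + z + r).
Let k11 y := heat (t + a + b) (y + z + p + r).

Let k00_le y : 0 <= k00 y <= E * heat (8 * t) y.
Proof.
by rewrite ltW ?heat_gt0//=; have := heat_k_le y i0 i0; rewrite !mul0r !addr0.
Qed.
Let k10_le y : 0 <= k10 y <= E * heat (8 * t) y.
Proof.
by rewrite ltW ?heat_gt0//=; have := heat_k_le y i1 i0; rewrite !mul0r !mul1r !addr0.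
Qed.
Let k01_le y : 0 <= k01 y <= E * heat (8 * t) y.
Proof.
by rewrite ltW ?heat_gt0//=; have := heat_k_le y i0 i1; rewrite !mul0r !mul1r !addr0.
Qed.
Let k11_le y : 0 <= k11 y <= E * heat (8 * t) y.
Proof.
by rewrite ltW ?heat_gt0//=; have := heat_k_le y i1 i1; rewrite !mul1r.
Qed.

Let diff_le l m y a' p' : 0 <= l <= 1 -> 0 <= m <= 1 -> 0 <= a' -> `|p'| <= L * a' ->
  `|heat (t + l * a + m * b) (y + z + l * p + m * r) *
    heat_dlog (t + l * a + m * b) (y + z + l * p + m * r) a' p'|
  <= D * a' / t * heat (8 * t) y.
Proof.
move=> l01 m01 a'0 p'L.
set T := t + l * a + m * b; set X := y + z + l * p + m * r.
have L1 : 0 <= 1 + L by rewrite addr_ge0.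
have [T0 T1 T2 T3 T4] := zT l01 m01; rewrite -/T in T0 T1 T2 T3 T4.
have v0 : 0 <= X ^+ 2 / T by rewrite divr_ge0 ?sqr_ge0 ?ltW.
have h0 := ltW (heat_gt0 T X); have h8 := ltW (heat_gt0 (8 * t) y).
rewrite normrM (ger0_norm h0).
have HA := heat_dlog_le X T0 T3 L0 a'0 p'L.
have HE : heat T X * (1 + X ^+ 2 / T) <= E * heat (8 * t) y.
  apply: le_trans (heat_pol y l01 m01); rewrite ler_wpM2l//.
  by rewrite -/X -/T ler_eXnr//; lra.
apply: (le_trans (ler_wpM2l h0 HA)).
rewrite mulrCA.
have HQ : (1 + L) * a' / T <= (1 + L) * a' / t.
  apply: ler_wpM2l; first exact: mulr_ge0.
  by rewrite lef_pV2 ?posrE.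
have Q0 : 0 <= (1 + L) * a' / t by rewrite divr_ge0 ?(mulr_ge0 L1)// ltW.
have Q1 : 0 <= (1 + L) * a' / T by rewrite divr_ge0 ?(mulr_ge0 L1)// ltW.
have eh0 : 0 <= heat T X * (1 + X ^+ 2 / T).
  by apply: mulr_ge0 => //; exact: addr_ge0.
apply: le_trans (ler_pM Q1 eh0 HQ HE) _.
have -> : D * a' / t * heat (8 * t) y = 2 * (1 + L) * ((1 + L) * a' / t * (E * heat (8 * t) y)).
  by rewrite /D /mixed_const; ring.
rewrite ler_peMl//; last by have := L0; lra.
by rewrite mulr_ge0// mulr_ge0// ltW.
Qed.

Let k10_k00 y : `|k10 y - k00 y| <= D * a / t * heat (8 * t) y.
Proof.
have [l l01 /= ->] := heat_diffE (y + z) p t0 a0.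
by have := diff_le y l01 i0 a0 pL; rewrite /= !mul0r !addr0.
Qed.

Let k01_k00 y : `|k01 y - k00 y| <= D * b / t * heat (8 * t) y.
Proof.
have [l l01 /= ->] := heat_diffE (y + z) r t0 b0.
by have := diff_le y i0 l01 b0 rL; rewrite /= !mul0r !addr0.
Qed.

Let k_mixed y : `|k11 y - k10 y - k01 y + k00 y| <= D * (a * b) / t ^+ 2 * heat (8 * t) y.
Proof.
have [l [m [l01 m01 /= ->]]] := heat_mixedE (y + z) p r t0 a0 b0.
set T := t + l * a + m * b; set X := y + z + l * p + m * r.
have [T0 T1 T2 T3 T4] := zT l01 m01; rewrite -/T in T0 T1 T2 T3 T4.
have v0 : 0 <= X ^+ 2 / T by rewrite divr_ge0 ?sqr_ge0 ?ltW.
have h0 := ltW (heat_gt0 T X); have h8 := ltW (heat_gt0 (8 * t) y).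
rewrite normrM (ger0_norm h0).
have HA := heat_dlog_le X T0 T3 L0 a0 pL.
have HB := heat_dlog_le X T0 T3 L0 b0 rL.
have HC := heat_dlog2_le X T0 T3 L0 a0 b0 pL rL.
set v := 1 + X ^+ 2 / T in HA HB HC.
have v1 : 1 <= v by rewrite lerDl.
set Q := (1 + L) ^+ 2 * (a * b).
have Q0 : 0 <= Q by rewrite mulr_ge0 ?sqr_ge0// mulr_ge0.
have T2i : 0 <= (T ^+ 2)^-1 by rewrite invr_ge0 sqr_ge0.
have HS : `|heat_dlog T X a p * heat_dlog T X b r + heat_dlog2 T X a p b r| <= 2 * (Q / T ^+ 2) * v ^+ 2.
  apply: le_trans (ler_normD _ _) _.
  have -> : 2 * (Q / T ^+ 2) * v ^+ 2 = Q / T ^+ 2 * v ^+ 2 + Q / T ^+ 2 * v ^+ 2 by ring.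
  apply: lerD.
    rewrite normrM; apply: le_trans (ler_pM _ _ HA HB) _ => //.
    by rewrite le_eqVlt; apply/orP; left; apply/eqP; rewrite /Q; field; rewrite gt_eqF.
  apply: le_trans HC _; rewrite -(mulrA (_ ^+ 2)) -/Q.
  apply: ler_wpM2l; first exact: mulr_ge0.
  by rewrite ler_eXnr.
apply: (le_trans (ler_wpM2l h0 HS)); rewrite mulrCA.
have HE : heat T X * v ^+ 2 <= E * heat (8 * t) y := heat_pol y l01 m01.
have HQ : 2 * (Q / T ^+ 2) <= 2 * (Q / t ^+ 2).
  rewrite ler_pM2l// ler_wpM2l// lef_pV2 ?posrE ?exprn_gt0//.
  by rewrite ler_pXn2r ?nnegrE ?(ltW t0) ?(ltW T0).
have Q1 : 0 <= 2 * (Q / T ^+ 2) by rewrite mulr_ge0// mulr_ge0.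
have eh0 : 0 <= heat T X * v ^+ 2 by rewrite mulr_ge0// sqr_ge0.
apply: le_trans (ler_pM Q1 eh0 HQ HE) _.
by rewrite le_eqVlt; apply/orP; left; apply/eqP; rewrite /D /mixed_const /Q; ring.
Qed.

Let w8 y := sqrD_heat_le y t0.

Let w8' y : (1 + y ^+ 2) * heat (8 * t) y <= 66 * heat (16 * t) y.
Proof.
have := heat_sqr_le y t0; have := heat8_le16 y t0; have := t0; have := t1.
have := heat_gt0 (8 * t) y; have := heat_gt0 (16 * t) y; nra.
Qed.

Variables (f00 f10 f01 f11 : R -> R).
Hypotheses (m00 : measurable_fun setT f00) (m10 : measurable_fun setT f10)
  (m01 : measurable_fun setT f01) (m11 : measurable_fun setT f11).
Hypotheses (h00 : forall y, `|f00 y| <= c * (y ^+ 2 + t))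
  (h10 : forall y, `|f10 y| <= c * (y ^+ 2 + t))
  (h01 : forall y, `|f01 y| <= c * (y ^+ 2 + t))
  (h11 : forall y, `|f11 y| <= c * (y ^+ 2 + t)).
Hypotheses (g1 : forall y, `|f11 y - f10 y| <= c * b * (1 + y ^+ 2))
  (g0 : forall y, `|f01 y - f00 y| <= c * b * (1 + y ^+ 2))
  (g2 : forall y, `|f11 y - f01 y| <= c * a * (1 + y ^+ 2))
  (gm : forall y, f11 y - f10 y - f01 y + f00 y = 0).

Let t16 : 0 < 16 * t. Proof. by rewrite mulr_gt0. Qed.

Let mk00 : measurable_fun setT k00. Proof. exact: measurable_heat. Qed.
Let mk10 : measurable_fun setT k10.
Proof.
have -> : k10 = fun y => heat (t + a) (y + (z + p)).
  by apply/funext => y; rewrite !addrA.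
by apply: measurable_heat; rewrite ltr_wpDr.
Qed.
Let mk01 : measurable_fun setT k01.
Proof.
have -> : k01 = fun y => heat (t + b) (y + (z + r)).
  by apply/funext => y; rewrite !addrA.
by apply: measurable_heat; rewrite ltr_wpDr.
Qed.
Let mk11 : measurable_fun setT k11.
Proof.
have -> : k11 = fun y => heat (t + a + b) (y + (z + p + r)).
  by apply/funext => y; rewrite !addrA.
by apply: measurable_heat; rewrite -addrA ltr_wpDr// addr_ge0.
Qed.

Let integrable_f00 : mu.-integrable setT (EFin \o (fun y => f00 y * k00 y)).
Proof. exact: integrable_quadratic_heat t0 c0 (ltW E0) m00 mk00 h00 k00_le. Qed.
Let integrable_f10 : mu.-integrable setT (EFin \o (fun y => f10 y * k10 y)).
Proof. exact: integrable_quadratic_heat t0 c0 (ltW E0) m10 mk10 h10 k10_le. Qed.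
Let integrable_f01 : mu.-integrable setT (EFin \o (fun y => f01 y * k01 y)).
Proof. exact: integrable_quadratic_heat t0 c0 (ltW E0) m01 mk01 h01 k01_le. Qed.
Let integrable_f11 : mu.-integrable setT (EFin \o (fun y => f11 y * k11 y)).
Proof. exact: integrable_quadratic_heat t0 c0 (ltW E0) m11 mk11 h11 k11_le. Qed.

(** Discrete Leibniz rule: as the mixed difference of the f's vanishes, that of
the products f k is the sum of f11 times the mixed difference of k and of two
products of one-sided differences. Integrated against a Gaussian of variance of
order t, f is O(t), so each term is O(a b / t). *)
Lemma heat_mixed_integral_le :
  `| \int[mu]_y (f11 y * k11 y) - \int[mu]_y (f10 y * k10 y)
     - \int[mu]_y (f01 y * k01 y) + \int[mu]_y (f00 y * k00 y) |
  <= 198 * c * D * (a * b) / t.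
Proof.
have i11 := integrable_f11; have i10 := integrable_f10.
have i01 := integrable_f01; have i00 := integrable_f00.
rewrite -RintegralB// -RintegralB//; last exact: integrableB i11 i10.
rewrite -RintegralD//; last exact: (integrableB measurableT (integrableB measurableT i11 i10) i01).
apply: (Rintegral_heat_le t16).
  apply: measurable_funD; last exact: measurable_funM.
  apply: measurable_funB; last exact: measurable_funM.
  by apply: measurable_funB; exact: measurable_funM.
move=> y.
have -> : f11 y * k11 y - f10 y * k10 y - f01 y * k01 y + f00 y * k00 y =
  f11 y * (k11 y - k10 y - k01 y + k00 y) + (f11 y - f10 y) * (k10 y - k00 y)
  + (f11 y - f01 y) * (k01 y - k00 y).
  by have -> : f00 y = f10 y + f01 y - f11 y by [have := gm y; lra]; ring.
have ab0 : 0 <= a * b by rewrite mulr_ge0.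
have ti : 0 < t^-1 by rewrite invr_gt0.
have W := w8 y; have W' := w8' y; have h8 := heat_gt0 (8 * t) y.
set Q := c * D * (a * b) / t.
have cD0 : 0 <= c * D by apply: mulr_ge0 => //; exact: ltW.
have Q0 : 0 <= Q by apply: divr_ge0; [exact: mulr_ge0|exact: ltW].
have B1 : `|f11 y * (k11 y - k10 y - k01 y + k00 y)| <= Q * (66 * heat (16 * t) y).
  rewrite normrM; apply: le_trans (ler_pM _ _ (h11 y) (k_mixed y)) _ => //.
  have -> : c * (y ^+ 2 + t) * (D * (a * b) / t ^+ 2 * heat (8 * t) y) =
    Q * ((y ^+ 2 + t) * heat (8 * t) y / t) by rewrite /Q; field; rewrite gt_eqF.
  rewrite ler_wpM2l// ler_pdivrMr// mulrAC; exact: W.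
have B2 : `|(f11 y - f10 y) * (k10 y - k00 y)| <= Q * (66 * heat (16 * t) y).
  rewrite normrM; apply: le_trans (ler_pM _ _ (g1 y) (k10_k00 y)) _ => //.
  have -> : c * b * (1 + y ^+ 2) * (D * a / t * heat (8 * t) y) =
    Q * ((1 + y ^+ 2) * heat (8 * t) y) by rewrite /Q; ring.
  by rewrite ler_wpM2l.
have B3 : `|(f11 y - f01 y) * (k01 y - k00 y)| <= Q * (66 * heat (16 * t) y).
  rewrite normrM; apply: le_trans (ler_pM _ _ (g2 y) (k01_k00 y)) _ => //.
  have -> : c * a * (1 + y ^+ 2) * (D * b / t * heat (8 * t) y) =
    Q * ((1 + y ^+ 2) * heat (8 * t) y) by rewrite /Q; ring.
  by rewrite ler_wpM2l.
apply: le_trans (ler_normD _ _) _; apply: (le_trans (lerD (ler_normD _ _) (lexx _))).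
have -> : 198 * c * D * (a * b) / t * heat (16 * t) y = 3 * (Q * (66 * heat (16 * t) y)).
  by rewrite /Q; ring.
lra.
Qed.

Lemma heat_diff_integral_le :
  `| \int[mu]_y (f01 y * k01 y) - \int[mu]_y (f00 y * k00 y) | <= 132 * c * D * b.
Proof.
have i01 := integrable_f01; have i00 := integrable_f00.
rewrite -RintegralB//.
apply: (Rintegral_heat_le t16).
  by apply: measurable_funB; exact: measurable_funM.
move=> y.
have -> : f01 y * k01 y - f00 y * k00 y = f01 y * (k01 y - k00 y) + (f01 y - f00 y) * k00 y.
  by ring.
have ti : 0 < t^-1 by rewrite invr_gt0.
have W := w8 y; have W' := w8' y; have h8 := heat_gt0 (8 * t) y.
set Q := c * D * b.
have cD0 : 0 <= c * D by apply: mulr_ge0 => //; exact: ltW.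
have Q0 : 0 <= Q by exact: mulr_ge0.
have B1 : `|f01 y * (k01 y - k00 y)| <= Q * (66 * heat (16 * t) y).
  rewrite normrM; apply: le_trans (ler_pM _ _ (h01 y) (k01_k00 y)) _ => //.
  have -> : c * (y ^+ 2 + t) * (D * b / t * heat (8 * t) y) =
    Q * ((y ^+ 2 + t) * heat (8 * t) y / t) by rewrite /Q; ring.
  rewrite ler_wpM2l// ler_pdivrMr// mulrAC; exact: W.
have B2 : `|(f01 y - f00 y) * k00 y| <= Q * (66 * heat (16 * t) y).
  have /andP[k0 kE] := k00_le y.
  rewrite normrM (ger0_norm k0); apply: le_trans (ler_pM _ _ (g0 y) (le_trans kE (ler_wpM2r (ltW h8) ED))) _ => //.
  have -> : c * b * (1 + y ^+ 2) * (D * heat (8 * t) y) =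
    Q * ((1 + y ^+ 2) * heat (8 * t) y) by rewrite /Q; ring.
  by rewrite ler_wpM2l.
apply: le_trans (ler_normD _ _) _.
have -> : 132 * c * D * b * heat (16 * t) y = 2 * (Q * (66 * heat (16 * t) y)).
  by rewrite /Q; ring.
lra.
Qed.
End mixed.
End integrals.

Section first_moment.
Context {R : realType}.
Implicit Types t x y z L : R.
Notation mu := (@lebesgue_measure R).

(** - t * heat t is a primitive of x * heat t x. *)
Let dF t z y : 0 < t ->
  is_derive y 1 (fun y => - (t * heat t (y + z))) ((y + z) * heat t (y + z)).
Proof.
move=> t0.
have T0 : 0 < t + y * 0 by rewrite mulr0 addr0.
have H := is_derive_heat z 1 T0; rewrite /= mulr0 addr0 mulr1 in H.
have H' : is_derive y 1 (fun y => heat t (y + z)) (- (y + z) / t * heat t (y + z)).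
  apply: (der_ext _ (der_eq H _)) => [l|]; first by rewrite mulr0 addr0 mulr1 addrC.
  by rewrite mulr0 mul0r subr0 sub0r mulr1 (addrC z); ring.
apply: (der_eq (der_opp (der_mul (der_cst t y) H'))); field; by rewrite gt_eqF.
Qed.

Let cheat t z : 0 < t -> continuous (fun y => heat t (y + z)).
Proof.
move=> t0 y; apply: (@continuous_comp _ _ _ (fun y => y + z) (heat t)); last exact: continuous_heat.
by apply: cvgD; [exact: cvg_id|exact: cvg_cst].
Qed.

Let cf t z : 0 < t -> continuous (fun y => (y + z) * heat t (y + z)).
Proof.
move=> t0 y; apply: cvgM; last exact: cheat.
by apply: cvgD; [exact: cvg_id|exact: cvg_cst].
Qed.

Let cF t z : 0 < t -> continuous (fun y => - (t * heat t (y + z))).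
Proof.
move=> t0 y; apply: cvgN; apply: cvgM; last exact: cheat.
exact: cvg_cst.
Qed.

Let Finfty t z : 0 < t -> (fun y => - (t * heat t (y + z))) x @[x --> +oo] --> (0 : R).
Proof.
move=> t0; rewrite -oppr0; apply: cvgN; rewrite -(mulr0 t); apply: cvgM; first exact: cvg_cst.
have H : (fun y => (y + z) ^+ 2 / (2 * t) + ln t / 2) x @[x --> +oo] --> +oo.
  apply/cvgryPge => A; near=> y.
  have y1 : 1 <= y + z by rewrite -lerBlDr; near: y; apply: nbhs_pinfty_ge; exact: num_real.
  have yA : (A - ln t / 2) * (2 * t) <= y + z.
    by rewrite -lerBlDr; near: y; apply: nbhs_pinfty_ge; exact: num_real.
  rewrite -lerBlDr ler_pdivlMr; last by rewrite mulr_gt0.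
  by apply: le_trans yA _; rewrite ler_eXnr.
have H2 := cvg_comp _ _ H (@cvgr_expR R).
rewrite -(mul0r (Num.sqrt (2 * pi))^-1).
apply: cvgM; last exact: cvg_cst.
apply: cvg_trans H2; apply: near_eq_cvg; near=> y => /=.
by congr expR; rewrite opprD mulNr.
Unshelve. all: by end_near. Qed.

Lemma integrable_first_moment t z : 0 < t -> t <= 1 ->
  mu.-integrable setT (EFin \o (fun y => (y + z) * heat t (y + z))).
Proof.
move=> t0 t1; have t8 : 0 < 8 * t by rewrite mulr_gt0.
have L0 : 0 <= `|z| / t by rewrite divr_ge0// ltW.
have zL : `|z| <= `|z| / t * t by rewrite divfK// gt_eqF.
apply: (@integrable_heat_dom _ _ (192 * expR ((`|z| / t) ^+ 2)) _ t8).
  apply: measurable_funM; last exact: measurable_heat.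
  by apply: measurable_funD.
move=> y.
have tt : t <= 2 * t by have := t0; lra.
apply: le_trans (@heat_poly_le R t t y z _ t0 (lexx t) tt t1 L0 zL).
rewrite normrM (ger0_norm (ltW (heat_gt0 _ _))) mulrC ler_pM2l ?heat_gt0//.
set x := y + z.
have v0 : 0 <= x ^+ 2 / t by rewrite divr_ge0 ?sqr_ge0 ?ltW.
apply: (@le_trans _ _ (1 + x ^+ 2 / t)); last by rewrite ler_eXnr// lerDl.
have : x ^+ 2 <= x ^+ 2 / t by rewrite ler_peMr ?sqr_ge0// invf_ge1.
rewrite -(@real_normK _ x) ?num_real//; have := sqr_ge0 (`|x| - 1); nra.
Qed.

Let moment_ge t z a : 0 < t -> t <= 1 -> 0 <= a + z ->
  \int[mu]_(y in `[a, +oo[) ((y + z) * heat t (y + z)) = t * heat t (a + z).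
Proof.
move=> t0 t1 az.
rewrite (@Rintegral_ge0_continuous_FTC2y _ _ (fun y => - (t * heat t (y + z))) a 0).
- by rewrite sub0r opprK.
- move=> x ax; apply: mulr_ge0; [lra|exact/ltW/heat_gt0].
- exact/continuous_subspaceT/cf.
- exact: Finfty.
- by move=> x _; have H := dF z x t0; exact: ex_derive.
- by apply: cvg_at_right_filter; exact: cF.
- by move=> x _; rewrite derive1E; have H := dF z x t0; exact: derive_val.
Qed.

(** For z < 0 the integrand changes sign at - z, and the half-line is cut there. *)
Lemma Rintegral_first_moment t z : 0 < t -> t <= 1 ->
  \int[mu]_(y in `[0, +oo[) ((y + z) * heat t (y + z)) = t * heat t z.
Proof.
move=> t0 t1; have [z0|z0] := leP 0 z.
  by rewrite moment_ge// ?add0r.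
have im := integrable_first_moment z t0 t1.
have := @Rintegral_itvB R (fun y => (y + z) * heat t (y + z)) (BLeft 0) +oo%O (- z).
rewrite Rintegral_itv_obnd_cbnd; last exact: integrableS im.
have -> : \int[mu]_(y in `[- z, +oo[) ((y + z) * heat t (y + z)) = t * heat t 0.
  by rewrite moment_ge// ?addNr.
move=> H.
have /H : mu.-integrable `[0, +oo[ (EFin \o (fun y => (y + z) * heat t (y + z))).
  exact: integrableS im.
rewrite !bnd_simp => /(_ _ isT) => {}H.
have -> : t * heat t z = t * heat t 0 + (t * heat t z - t * heat t 0) by ring.
rewrite -[X in _ = X + _]H; last by rewrite oppr_ge0 ltW.
rewrite -addrA; apply/eqP; rewrite -subr_eq0 opprD addrA subrr sub0r opprD opprK.
have -> : \int[mu]_(y in `[0, - z]) ((y + z) * heat t (y + z)) = t * heat t z - t * heat t 0.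
  rewrite /Rintegral (@continuous_FTC2 _ _ (fun y => - (t * heat t (y + z)))).
  - by rewrite -EFinB/= addNr add0r; ring.
  - by rewrite oppr_gt0.
  - exact/continuous_subspaceT/cf.
  - split.
    + by move=> x _; have D := dF z x t0; exact: ex_derive.
    + by apply: cvg_at_right_filter; exact: cF.
    + by apply: cvg_at_left_filter; exact: cF.
  - by move=> x _; rewrite derive1E; have D := dF z x t0; exact: derive_val.
by apply/eqP; ring.
Qed.

End first_moment.

(** * The mixed difference over a short rectangle *)

Lemma combine_estimates (R : realType) (Rc E beta g m M0i A1 k S St Ta C2 C5 : R) :
 - (Rc + beta * (g * (m / 4))) <= E + C5 * Ta ->
 Rc + beta * (g * (m / 4)) <= E + C5 * Ta ->
 C5 * Ta <= k / 4 * S * m ->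
 C5 * Ta <= C5 * St * m ->
 E <= M0i / 8 * (g * m) ->
 E <= A1 * C2 * (St * m) ->
 M0i * (g * (m / 4)) <= beta * (g * (m / 4)) ->
 beta * (g * (m / 4)) <= A1 * (St * (m / 4)) ->
 k / 2 * S * m <= M0i / 8 * (g * m) -> 0 <= St * m ->
 - (A1 / 4 + A1 * C2 + C5 + 1) * St * m <= Rc <= - (k / 4) * S * m.
Proof. move=> *; apply/andP; split; lra. Qed.
(** The local estimate is proved for functions C, u, q, K with the analytic
properties of the distribution functions, the densities, the quantiles and the
probabilities P(B(s) <= q(s), B(t) > q(t)) over the time interval [0,H]. *)
Section local_estimate.
Context {R : realType}.
Notation mu := (@lebesgue_measure R).
Implicit Types s t x y tau : R.
Variables (C u K : R -> R -> R) (q : R -> R) (alpha H M0 M1 K2 L A d0 : R).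
Hypotheses (alpha01 : 0 < alpha < 1)
  (M0_gt0 : 0 < M0) (M1_ge0 : 0 <= M1) (K2_ge0 : 0 <= K2) (L_ge0 : 0 <= L)
  (A_gt0 : 0 < A) (d0_gt0 : 0 < d0).
Hypotheses
  (dC : forall t x : R, 0 <= t -> is_derive x 1 (C ^~ t) (u x t))
  (u_bnd : forall t x : R, 0 <= t -> 0 <= u x t <= M0)
  (u_lip : forall t x y : R, 0 <= t -> `|u x t - u y t| <= M1 * `|x - y|)
  (u_time : forall s t x : R, 0 <= s -> 0 <= t -> `|u x t - u x s| <= K2 * `|t - s|)
  (q_cdf : forall t : R, 0 <= t -> C (q t) t = alpha)
  (q_lip : forall s t : R, 0 <= s <= H -> 0 <= t <= H -> `|t - s| <= d0 ->
     `|q t - q s| <= L * `|t - s|)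
  (u_quantile_ge : forall t : R, 0 <= t <= H -> A <= u (q t) t)
  (K_formula : forall s t : R, 0 <= s -> s < t -> K s t =
     \int[mu]_y (Num.max 0 (alpha - C (q s - y) s) * heat (t - s) (y + (q t - q s)))).

Let a t := u (q t) t.
Let b t := (a t)^-1.
Let gam s y := alpha - C (q s - y) s.
Let rho s t := (alpha - K s t - alpha ^+ 2) / (a s * a t).
Let B := M1 * L + K2.
Let B0 : 0 <= B. Proof. by rewrite addr_ge0// mulr_ge0. Qed.

Let dgam s y : 0 <= s -> is_derive y 1 (gam s) (u (q s - y) s).
Proof.
move=> s0.
have d1 : is_derive y 1 (fun y : R => q s - y) (- 1).
  by apply: (der_eq (der_add (der_cst (q s) y) (der_opp (der_id y)))); rewrite add0r.
have H1 := der_comp d1 (dC (q s - y) s0).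
by apply: (der_eq (der_add (der_cst alpha y) (der_opp H1))); rewrite add0r mulrN1 opprK.
Qed.

Let gam0 s : 0 <= s -> gam s 0 = 0.
Proof. by move=> s0; rewrite /gam subr0 q_cdf// subrr. Qed.

Let gam_le s y : 0 <= s -> 0 <= y -> 0 <= gam s y <= M0 * y.
Proof.
move=> s0 y0.
have [c _] := mean_value y0 (fun x _ => dgam x s0).
rewrite gam0// !subr0 => ->.
by have /andP[u0 u1] := u_bnd (q s - c) s0; rewrite mulr_ge0//= ler_wpM2r.
Qed.

Let gam_neg s y : 0 <= s -> y <= 0 -> gam s y <= 0.
Proof.
move=> s0 y0.
have [c _] := mean_value y0 (fun x _ => dgam x s0).
rewrite gam0// sub0r => E.
have /andP[u0 _] := u_bnd (q s - c) s0.
by rewrite -oppr_ge0 E sub0r; apply: mulr_ge0 => //; rewrite oppr_ge0.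
Qed.

(** First-order expansion at the quantile; the error is quadratic since u is
Lipschitz in space. *)
Let gam_lin s y : 0 <= s -> 0 <= y -> `|gam s y - a s * y| <= M1 * y ^+ 2.
Proof.
move=> s0 y0.
have [c /andP[c0 cy]] := mean_value y0 (fun x _ => dgam x s0).
rewrite gam0// !subr0 => ->; rewrite -mulrBl normrM (ger0_norm y0) expr2 mulrA.
apply: ler_wpM2r => //; apply: (le_trans (u_lip _ _ s0)).
apply: ler_wpM2l => //; by rewrite addrC addKr normrN ger0_norm.
Qed.

Let u_move s s' y : 0 <= s <= H -> 0 <= s' <= H -> `|s - s'| <= d0 ->
  `|u (q s - y) s - u (q s' - y) s'| <= B * `|s - s'|.
Proof.
move=> /[dup] hs /andP[s0 _] /[dup] hs' /andP[s'0 _] ss.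
have -> : u (q s - y) s - u (q s' - y) s' =
  (u (q s - y) s - u (q s' - y) s) + (u (q s' - y) s - u (q s' - y) s') by ring.
apply: (le_trans (ler_normD _ _)); rewrite mulrDl; apply: lerD; last exact: u_time.
apply: (le_trans (u_lip _ _ s0)); rewrite -mulrA ler_wpM2l//.
have -> : q s - y - (q s' - y) = q s - q s' by ring.
exact: q_lip.
Qed.

Let gam_move s s' y : 0 <= s <= H -> 0 <= s' <= H -> `|s - s'| <= d0 -> 0 <= y ->
  `|gam s y - gam s' y| <= B * `|s - s'| * y.
Proof.
move=> /[dup] hs /andP[s0 _] /[dup] hs' /andP[s'0 _] ss y0.
have [c _] := mean_value y0 (fun x _ => der_add (dgam x s0) (der_opp (dgam x s'0))).
rewrite !gam0// !subr0 => ->; rewrite normrM (ger0_norm y0) ler_wpM2r//.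
exact: u_move.
Qed.

Let a_move s s' : 0 <= s <= H -> 0 <= s' <= H -> `|s - s'| <= d0 ->
  `|a s - a s'| <= B * `|s - s'|.
Proof. by move=> hs hs' ss; have := u_move 0 hs hs' ss; rewrite !subr0. Qed.

Let a_gt0 s : 0 <= s <= H -> 0 < a s.
Proof. by move=> hs; apply: lt_le_trans A_gt0 _; exact: u_quantile_ge. Qed.

Let b_bnd s : 0 <= s <= H -> M0^-1 <= b s <= A^-1.
Proof.
move=> /[dup] hs /andP[s0 _]; have as0 := a_gt0 hs.
by rewrite !lef_pV2 ?posrE// u_quantile_ge// andbT; have /andP[] := u_bnd (q s) s0.
Qed.

Let b_move s s' : 0 <= s <= H -> 0 <= s' <= H -> `|s - s'| <= d0 ->
  `|b s - b s'| <= B / A ^+ 2 * `|s - s'|.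
Proof.
move=> hs hs' ss; have as0 := a_gt0 hs; have as'0 := a_gt0 hs'.
have -> : b s - b s' = (a s' - a s) * (b s * b s').
  by rewrite /b; field; rewrite !gt_eqF.
rewrite normrM mulrAC; apply: ler_pM => //.
  by rewrite distrC; exact: a_move.
have /andP[b0 b1] := b_bnd hs; have /andP[b0' b1'] := b_bnd hs'.
have bs0 : 0 <= b s by rewrite invr_ge0 ltW.
have bs'0 : 0 <= b s' by rewrite invr_ge0 ltW.
by rewrite ger0_norm ?mulr_ge0// expr2 invfM ler_pM.
Qed.

Let pos y : R := (0 <= y)%R%:R.
(** What is left of b(s) max(0, gam s y) once the function (y + z) on y >= 0, of
explicit integral, is subtracted. Its mixed difference in (s,t) vanishes because
z = q(t) - q(s). *)
Let phi s t y := pos y * (b s * gam s y - (y + (q t - q s))).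

Let mpos : measurable_fun setT pos.
Proof.
rewrite (_ : pos = \1_(`[0, +oo[%classic)); first exact: measurable_indic.
apply/funext => y; rewrite /pos indicE; congr (_%:R).
by congr nat_of_bool; apply/idP/idP; rewrite inE/= in_itv/= andbT.
Qed.

Let mgam s : 0 <= s -> measurable_fun setT (gam s).
Proof.
move=> s0; apply: continuous_measurable_fun => y.
have D := dgam y s0.
by apply/differentiable_continuous/derivable1_diffP; exact: ex_derive.
Qed.

Let mphi s t : 0 <= s -> measurable_fun setT (phi s t).
Proof.
move=> s0; apply: measurable_funM => //.
apply: measurable_funB; first by apply: measurable_funM => //; exact: mgam.
by apply: measurable_funD.
Qed.

Let c0 := M1 / A + 2 * L + B / A ^+ 2 * M0 + B / A.
Let iA0 : 0 <= A^-1. Proof. by rewrite invr_ge0 ltW. Qed.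
Let consts_ge0 : [/\ 0 <= M1 / A, 0 <= B / A ^+ 2 * M0 & 0 <= B / A].
Proof.
split; [exact: mulr_ge0| |exact: mulr_ge0].
by apply: mulr_ge0; [apply: divr_ge0 => //; exact: sqr_ge0|exact: ltW].
Qed.
Let c00 : 0 <= c0.
Proof.
have [MA BA BA'] := consts_ge0.
by rewrite /c0; have := L_ge0; lra.
Qed.

Let phi_le s t tau y : 0 <= s <= H -> 0 <= t <= H -> `|t - s| <= d0 ->
  0 <= tau -> `|t - s| <= 2 * tau -> `|phi s t y| <= c0 * (y ^+ 2 + tau).
Proof.
move=> hs ht ts tau0 ttau; have s0 : 0 <= s by case/andP: hs.
have yt : 0 <= y ^+ 2 + tau by rewrite addr_ge0 ?sqr_ge0.
rewrite /phi /pos; have [y0|y0] := leP 0 y; last first.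
  by rewrite mul0r normr0 mulr_ge0.
rewrite mul1r.
have as0 := a_gt0 hs; have /andP[b0 b1] := b_bnd hs.
have bs0 : 0 <= b s by rewrite invr_ge0 ltW.
have -> : b s * gam s y - (y + (q t - q s)) = b s * (gam s y - a s * y) - (q t - q s).
  by rewrite /b; field; rewrite gt_eqF.
have e1 : `|b s * (gam s y - a s * y)| <= M1 / A * y ^+ 2.
  rewrite normrM (ger0_norm bs0) mulrAC [leRHS]mulrC.
  by apply: ler_pM => //; exact: gam_lin.
have e2 : `|q t - q s| <= 2 * L * tau.
  apply: (le_trans (q_lip hs ht ts)).
  have -> : 2 * L * tau = L * (2 * tau) by ring.
  by rewrite ler_wpM2l.
apply: (le_trans (ler_normB _ _)).
have [MA BA BA'] := consts_ge0.
apply: (le_trans (lerD e1 e2)).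
apply: (@le_trans _ _ (M1 / A * (y ^+ 2 + tau) + 2 * L * (y ^+ 2 + tau))).
  by apply: lerD; apply: ler_wpM2l => //; rewrite ?mulr_ge0// ?lerDl ?lerDr// sqr_ge0.
rewrite -mulrDl ler_wpM2r//.
by rewrite /c0 -addrA lerDl addr_ge0.
Qed.

Let pos01 y : 0 <= pos y <= 1. Proof. by rewrite /pos; case: (0 <= y); rewrite ?lexx ?ler01. Qed.

Let phi_dt s t t' y : 0 <= t <= H -> 0 <= t' <= H -> `|t' - t| <= d0 ->
  `|phi s t' y - phi s t y| <= c0 * `|t' - t| * (1 + y ^+ 2).
Proof.
move=> ht ht' tt.
have -> : phi s t' y - phi s t y = - (pos y * (q t' - q t)) by rewrite /phi; ring.
rewrite normrN normrM; have /andP[p0 p1] := pos01 y; rewrite (ger0_norm p0).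
have [MA BA BA'] := consts_ge0.
apply: (@le_trans _ _ (`|q t' - q t|)); first by rewrite ler_piMl.
apply: (le_trans (q_lip ht ht' tt)); rewrite -[leLHS]mulr1; apply: ler_pM => //.
- by rewrite mulr_ge0.
- by rewrite ler_wpM2r// /c0; have := L_ge0; lra.
- by rewrite lerDl sqr_ge0.
Qed.

Let phi_ds s s' t y : 0 <= s <= H -> 0 <= s' <= H -> `|s' - s| <= d0 ->
  `|phi s' t y - phi s t y| <= c0 * `|s' - s| * (1 + y ^+ 2).
Proof.
move=> hs hs' ss; have s0 : 0 <= s by case/andP: hs.
have s'0 : 0 <= s' by case/andP: hs'.
have [MA BA BA'] := consts_ge0.
rewrite /phi /pos; have [y0|y0] := leP 0 y; last first.
  by rewrite !mul0r subrr normr0 !mulr_ge0// addr_ge0// sqr_ge0.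
rewrite !mul1r.
have bs'0 : 0 <= b s' by rewrite invr_ge0 ltW// a_gt0.
have -> : b s' * gam s' y - (y + (q t - q s')) - (b s * gam s y - (y + (q t - q s))) =
  (b s' - b s) * gam s y + b s' * (gam s' y - gam s y) + (q s' - q s) by ring.
set D := `|s' - s|.
have D0 : 0 <= D := normr_ge0 _.
have e1 : `|(b s' - b s) * gam s y| <= B / A ^+ 2 * M0 * D * y.
  have /andP[g0 g1] := gam_le s0 y0.
  rewrite normrM (ger0_norm g0).
  have -> : B / A ^+ 2 * M0 * D * y = (B / A ^+ 2 * D) * (M0 * y) by ring.
  by apply: ler_pM => //; exact: b_move.
have e2 : `|b s' * (gam s' y - gam s y)| <= B / A * D * y.
  rewrite normrM (ger0_norm bs'0).
  have -> : B / A * D * y = A^-1 * (B * D * y) by ring.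
  apply: ler_pM => //; first by have /andP[] := b_bnd hs'.
  exact: gam_move.
have e3 : `|q s' - q s| <= L * D by exact: q_lip.
apply: (le_trans (ler_normD _ _)).
apply: (le_trans (lerD (ler_normD _ _) (lexx _))).
apply: (le_trans (lerD (lerD e1 e2) e3)).
have y1 : y <= 1 + y ^+ 2 by have := sqr_ge0 (y - 1); nra.
have y2 : 1 <= 1 + y ^+ 2 by rewrite lerDl sqr_ge0.
apply: (@le_trans _ _ ((B / A ^+ 2 * M0 * D + B / A * D + L * D) * (1 + y ^+ 2))).
  rewrite [leRHS]mulrDl [X in _ <= X + _]mulrDl; apply: lerD; first apply: lerD.
  - by apply: ler_wpM2l => //; exact: mulr_ge0.
  - by apply: ler_wpM2l => //; exact: mulr_ge0.
  - by apply: ler_peMr => //; exact: mulr_ge0.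
apply: ler_wpM2r; first by rewrite addr_ge0// sqr_ge0.
rewrite -!mulrDl ler_wpM2r// /c0; have := L_ge0; lra.
Qed.

(** As b is the inverse of the density at the quantile, the explicit term has
coefficient 1: it depends on (s,t) only through (tau,z). *)
Let K_split s t : 0 <= s -> s < t -> s <= H -> t <= H -> t - s <= d0 -> 2 * (t - s) <= 1 ->
  b s * K s t = (t - s) * heat (t - s) (q t - q s)
    + \int[mu]_y (phi s t y * heat (t - s) (y + (q t - q s))).
Proof.
move=> s0 st sH tH ts0 ts1.
have tau0 : 0 < t - s by rewrite subr_gt0.
have hs : 0 <= s <= H by rewrite s0.
have ht : 0 <= t <= H by rewrite tH (le_trans s0 (ltW st)).
have nts : `|t - s| = t - s by rewrite ger0_norm// ltW.
set tau := t - s in tau0 ts0 ts1 nts *; set z := q t - q s.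
have t1 : tau <= 1 by lra.
rewrite -(Rintegral_first_moment z tau0 t1) Rintegral_mkcond.
have im := integrable_first_moment z tau0 t1.
have zL : `|z| <= L * tau by have := q_lip hs ht; rewrite -/tau -/z nts; apply.
have ip : mu.-integrable setT (EFin \o (fun y => phi s t y * heat tau (y + z))).
  pose e := 192 * expR (L ^+ 2).
  have e0 : 0 <= e by apply: mulr_ge0 => //; exact: expR_ge0.
  have tau2 : tau <= 2 * tau by lra.
  apply: (@integrable_quadratic_heat _ _ _ c0 e tau) => // [||y|y].
  - exact: mphi.
  - exact: measurable_heat.
  - by apply: phi_le => //; rewrite -/tau ?nts// ltW.
  rewrite ltW ?heat_gt0//=; have := heat_poly_le y tau0 (lexx _) tau2 t1 L_ge0 zL.
  apply: le_trans; apply: ler_peMr; first exact/ltW/heat_gt0.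
  by apply: exprn_ege1; rewrite lerDl divr_ge0 ?sqr_ge0 ?(ltW tau0).
have i1 : mu.-integrable setT
    (EFin \o ((fun y0 => (y0 + z) * heat tau (y0 + z)) \_ `[0, +oo[)).
  rewrite -restrict_EFin; apply/integrable_restrict => //.
  by rewrite setTI; exact: integrableS im.
rewrite -RintegralD//.
rewrite K_formula// -/tau -/z.
have bs0 : 0 < b s by rewrite invr_gt0 a_gt0.
have := @RintegralZl _ _ R mu setT (fun y => Num.max 0 (alpha - C (q s - y) s) * heat tau (y + z)) (b s) measurableT.
have E y : b s * (Num.max 0 (alpha - C (q s - y) s) * heat tau (y + z)) =
   (((fun y0 => (y0 + z) * heat tau (y0 + z)) \_ `[0, +oo[) y + phi s t y * heat tau (y + z)).
  rewrite patchE /phi /pos -/(gam s y) -/z.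
  have [y0|y0] := leP 0 y.
    rewrite mem_set/= ?in_itv/= ?y0// mul1r max_r; last by case/andP: (gam_le s0 y0).
    by ring.
  rewrite memNset/= ?in_itv/= ?andbT; last by apply/negP; rewrite -ltNge.
  by rewrite !mul0r max_l ?mul0r ?mulr0 ?addr0// gam_neg// ltW.
move=> <-; first by apply: eq_Rintegral => y _; rewrite E.
have iE : mu.-integrable setT (EFin \o (fun y => b s * (Num.max 0 (alpha - C (q s - y) s) * heat tau (y + z)))).
  have := integrableD measurableT i1 ip; apply: eq_integrable => // y _.
  by rewrite /= E.
have := integrableZl measurableT (b s)^-1 iE.
by apply: eq_integrable => // y _ /=; rewrite -EFinM mulKf// gt_eqF.
Qed.


Notation kappa := (Num.sqrt (2 * pi : R))^-1.
Let k1 := kappa * expR (- L ^+ 2) / (4 * M0).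
Let C2 := 6 * L ^+ 2 + 4 * L ^+ 4.
Let C3 := 198 * c0 * mixed_const L.
Let C4 := (1 + (1 + L) * (1 + L ^+ 2)) + 132 * c0 * mixed_const L.
Let Bb := B / A ^+ 2.
Let C5 := Bb ^+ 2 + A^-1 * C3 + Bb * C4.

Let C2_ge0 : 0 <= C2.
Proof. by rewrite /C2 addr_ge0// mulr_ge0// exprn_ge0. Qed.
Let mixC_ge0 : 0 <= mixed_const L.
Proof.
apply: mulr_ge0; first by apply: mulr_ge0 => //; exact: sqr_ge0.
by apply: mulr_ge0 => //; exact: expR_ge0.
Qed.
Let C3_ge0 : 0 <= C3.
Proof. by apply: mulr_ge0 => //; apply: mulr_ge0. Qed.
Let C4_ge0 : 0 <= C4.
Proof.
apply: addr_ge0; last by apply: mulr_ge0 => //; apply: mulr_ge0.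
apply: addr_ge0 => //; apply: mulr_ge0; apply: addr_ge0 => //; exact: sqr_ge0.
Qed.
Let Bb_ge0 : 0 <= Bb. Proof. by rewrite divr_ge0// sqr_ge0. Qed.
Let C5_ge0 : 0 <= C5.
Proof.
apply: addr_ge0; last exact: mulr_ge0.
by apply: addr_ge0; [exact: sqr_ge0|exact: mulr_ge0].
Qed.
Let k1_gt0 : 0 < k1.
Proof.
apply: divr_gt0; last exact: mulr_gt0.
by apply: mulr_gt0; [exact: kappa_gt0|exact: expR_gt0].
Qed.

Let rect s' s t t' := rho s t' - rho s t - rho s' t' + rho s' t.

Let rho_split s t : 0 <= s -> s < t -> t <= H ->
  rho s t = b t * ((alpha - alpha ^+ 2) * b s - b s * K s t).
Proof.
move=> s0 st tH; have hs : 0 <= s <= H by apply/andP; split; lra.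
have ht : 0 <= t <= H by apply/andP; split; lra.
by rewrite /rho /b; field; rewrite !gt_eqF// a_gt0.
Qed.

Let var_le1 : `|alpha - alpha ^+ 2| <= 1.
Proof.
by have /andP[al0 al1] := alpha01; rewrite ler_norml; apply/andP; split; nra.
Qed.

(** T and X are the intermediate values of tau and z. The last term collects the
contributions of the remainder phi and of the variations of b. *)
Let rect_approx s' s t t' : 0 <= s' -> s' <= s -> s < t -> t <= t' -> t' <= H ->
  (t' - t) + (s - s') <= t - s -> t' - s' <= d0 -> t' - s' <= 2^-1 ->
  exists T X : R, [/\ t - s <= T, T <= t' - s', `|X| <= L * T &
    `|rect s' s t t' + b t' * (heat T X / T * ((t' - t) * (s - s') / 4))|
    <= A^-1 * (heat T X * (C2 * ((t' - t) * (s - s')))) + C5 * ((t' - t) * (s - s')) / (t - s)].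
Proof.
move=> s'0 ss st tt t'H hab hd hh.
have s0 : 0 <= s by lra.
have sH : s <= H by lra.
have s'H : s' <= H by lra.
have tH : t <= H by lra.
have st' : s < t' by lra.
have s't : s' < t by lra.
have s't' : s' < t' by lra.
have d00 : t - s <= d0 by lra.
have d10 : t' - s <= d0 by lra.
have d01 : t - s' <= d0 by lra.
have h00 : 2 * (t - s) <= 1 by lra.
have h10 : 2 * (t' - s) <= 1 by lra.
have h01 : 2 * (t - s') <= 1 by lra.
have h11 : 2 * (t' - s') <= 1 by lra.
have N d : 0 < d -> d <= 2 * (t - s) -> `|d| <= 2 * (t - s).
  by move=> d_gt0; rewrite ger0_norm// ltW.
have M d : 0 < d -> d <= d0 -> `|d| <= d0.
  by move=> d_gt0; rewrite ger0_norm// ltW.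
have w00 : `|t - s| <= 2 * (t - s) by apply: N; lra.
have w10 : `|t' - s| <= 2 * (t - s) by apply: N; lra.
have w01 : `|t - s'| <= 2 * (t - s) by apply: N; lra.
have w11 : `|t' - s'| <= 2 * (t - s) by apply: N; lra.
have v00 : `|t - s| <= d0 by apply: M; lra.
have v10 : `|t' - s| <= d0 by apply: M; lra.
have v01 : `|t - s'| <= d0 by apply: M; lra.
have v11 : `|t' - s'| <= d0 by apply: M; lra.
pose tau := t - s; pose da := t' - t; pose db := s - s'.
pose z := q t - q s; pose p := q t' - q t; pose r := q s - q s'.
have da0 : 0 <= da by rewrite /da; lra.
have db0 : 0 <= db by rewrite /db; lra.
have tau0 : 0 < tau by rewrite /tau; lra.
have hs : 0 <= s <= H by rewrite s0.
have hs' : 0 <= s' <= H by rewrite s'0.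
have ht : 0 <= t <= H by rewrite (le_trans s0 (ltW st)).
have ht' : 0 <= t' <= H by rewrite (le_trans s'0 (ltW s't')).
have n1 : `|t - s| = tau by rewrite ger0_norm// ltW.
have n2 : `|t' - t| = da by rewrite ger0_norm.
have n3 : `|s - s'| = db by rewrite ger0_norm.
have taud : tau <= d0 := d00.
have hab' : da + db <= tau := hab.
have dad : da <= d0 by rewrite (le_trans _ d00)// (le_trans _ hab')// lerDl.
have dbd : db <= d0 by rewrite (le_trans _ d00)// (le_trans _ hab')// lerDr.
have zL : `|z| <= L * tau by have := q_lip hs ht; rewrite n1; apply.
have pL : `|p| <= L * da by have := q_lip ht ht'; rewrite n2; apply.
have rL : `|r| <= L * db by have := q_lip hs' hs; rewrite n3; apply.
have tau1 : 2 * tau <= 1 := h00.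
have sum1 : tau + da + db <= 1.
  by rewrite -addrA (le_trans _ h00)// mulr_natl mulr2n lerD2l.
have sumb1 : tau + db <= 1 by rewrite (le_trans _ sum1)// lerD2r lerDl.
have [T [X [tT Tt XL Happ]]] := heat_scaled_mixed_le tau0 da0 db0 sum1 L_ge0 zL pL rL.
exists T, X; split => //.
  by move: Tt; rewrite /tau /da /db => /le_trans; apply; rewrite le_eqVlt; apply/orP; left; apply/eqP; ring.
have bst' : 0 <= b t' by rewrite invr_ge0 ltW// a_gt0.
have P00 y := phi_le y hs ht v00 (ltW tau0) w00.
have e10 : t' - s = tau + da by rewrite /tau /da; ring.
have e01 : t - s' = tau + db by rewrite /tau /db; ring.
have e11 : t' - s' = tau + da + db by rewrite /tau /da /db; ring.
have P10 y := phi_le y hs ht' v10 (ltW tau0) w10.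
have P01 y := phi_le y hs' ht v01 (ltW tau0) w01.
have P11 y := phi_le y hs' ht' v11 (ltW tau0) w11.
have n3' : `|s' - s| = db by rewrite distrC.
have Q1 y : `|phi s' t' y - phi s t' y| <= c0 * db * (1 + y ^+ 2).
  by have := phi_ds t' y hs hs'; rewrite n3'; apply.
have Q0 y : `|phi s' t y - phi s t y| <= c0 * db * (1 + y ^+ 2).
  by have := phi_ds t y hs hs'; rewrite n3'; apply.
have Q2 y : `|phi s' t' y - phi s' t y| <= c0 * da * (1 + y ^+ 2).
  by have := phi_dt s' y ht ht'; rewrite n2; apply.
have Qm y : phi s' t' y - phi s t' y - phi s' t y + phi s t y = 0.
  by rewrite /phi; ring.
have m00 := mphi t s0; have m10 := mphi t' s0.
have m01 := mphi t s'0; have m11 := mphi t' s'0.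
have HI := heat_mixed_integral_le tau0 da0 db0 hab' tau1 L_ge0 c00 zL pL rL
  m00 m10 m01 m11 P00 P10 P01 P11 Q1 Q2 Qm.
have HJ := heat_diff_integral_le tau0 da0 db0 hab' tau1 L_ge0 c00 zL pL rL m00 m01 P00 P01 Q0.
have HE := heat_scaled_diff_le tau0 db0 sumb1 L_ge0 zL rL.
have E00 := K_split s0 st sH tH d00 h00.
have E10 := K_split s0 st' sH t'H d10 h10.
have E01 := K_split s'0 s't s'H tH d01 h01.
have E11 := K_split s'0 s't' s'H t'H hd h11.
have z10 : q t' - q s = z + p by rewrite /z /p; ring.
have z01 : q t - q s' = z + r by rewrite /z /r; ring.
have z11 : q t' - q s' = z + p + r by rewrite /z /p /r; ring.
rewrite -/tau -/z in E00; rewrite e10 z10 in E10.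
rewrite e01 z01 in E01; rewrite e11 z11 in E11.
move: HI HJ; rewrite /=.
set I00 := \int[mu]_y (phi s t y * _); set I10 := \int[mu]_y (phi s t' y * _).
set I01 := \int[mu]_y (phi s' t y * _); set I11 := \int[mu]_y (phi s' t' y * _).
move=> HI HJ.
have {}E10 : b s * K s t' = (tau + da) * heat (tau + da) (z + p) + I10.
  rewrite E10; congr (_ + _); apply: eq_Rintegral => y _.
  by rewrite !addrA.
have {}E01 : b s' * K s' t = (tau + db) * heat (tau + db) (z + r) + I01.
  rewrite E01; congr (_ + _); apply: eq_Rintegral => y _.
  by rewrite !addrA.
have {}E11 : b s' * K s' t' = (tau + da + db) * heat (tau + da + db) (z + p + r) + I11.
  rewrite E11; congr (_ + _); apply: eq_Rintegral => y _.
  by rewrite !addrA.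
rewrite /rect !rho_split//.
rewrite E00 E10 E01 E11 -/da -/db.
move: Happ HE.
set m_00 := tau * _; set m_10 := (tau + da) * _; set m_01 := (tau + db) * _.
set m_11 := (tau + da + db) * _; set h := heat T X.
move=> Happ HE.
set c := alpha - alpha ^+ 2.
(* Discrete Leibniz rule for the product of b(t) and (alpha - alpha^2) b(s) - b(s) K. *)
have -> : b t' * (c * b s - (m_10 + I10)) - b t * (c * b s - (m_00 + I00))
   - b t' * (c * b s' - (m_11 + I11)) + b t * (c * b s' - (m_01 + I01))
   + b t' * (h / T * (da * db / 4)) =
   c * (b t' - b t) * (b s - b s')
   + b t' * (m_11 - m_10 - m_01 + m_00 + h / T * (da * db / 4))
   + b t' * (I11 - I10 - I01 + I00)
   + (b t' - b t) * ((m_01 - m_00) + (I01 - I00)) by ring.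
have c1 : `|c| <= 1 := var_le1.
have B1 : `|b t' - b t| <= Bb * da by have := b_move ht' ht; rewrite n2; apply.
have B2 : `|b s - b s'| <= Bb * db by have := b_move hs hs'; rewrite n3; apply.
have bA : b t' <= A^-1 by have /andP[] := b_bnd ht'.
have ti : 1 <= tau^-1 by rewrite invf_ge1// (le_trans _ h00)// ler_peMl ?ler1n// ltW.
have dab : 0 <= da * db by exact: mulr_ge0.
have F1 : `|c * (b t' - b t) * (b s - b s')| <= Bb ^+ 2 * (da * db) / tau.
  rewrite 2!normrM.
  apply: (@le_trans _ _ (1 * (Bb * da) * (Bb * db))).
    by apply: ler_pM => //; apply: ler_pM.
  have -> : 1 * (Bb * da) * (Bb * db) = Bb ^+ 2 * (da * db) by ring.
  by apply: ler_peMr => //; apply: mulr_ge0 => //; exact: sqr_ge0.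
have F2 : `|b t' * (m_11 - m_10 - m_01 + m_00 + h / T * (da * db / 4))| <=
    A^-1 * (h * (C2 * (da * db))).
  by rewrite normrM (ger0_norm bst'); apply: ler_pM.
have F3 : `|b t' * (I11 - I10 - I01 + I00)| <= A^-1 * C3 * (da * db) / tau.
  rewrite normrM (ger0_norm bst') -!mulrA; apply: ler_pM => //.
  by apply: (le_trans HI); rewrite /C3 -!mulrA.
have F4 : `|(b t' - b t) * ((m_01 - m_00) + (I01 - I00))| <= Bb * C4 * (da * db) / tau.
  rewrite normrM.
  have -> : Bb * C4 * (da * db) / tau = (Bb * da) * (C4 * db / tau) by ring.
  apply: ler_pM => //; apply: (le_trans (ler_normD _ _)).
  have -> : C4 * db / tau = (1 + (1 + L) * (1 + L ^+ 2)) * db / tau + 132 * c0 * mixed_const L * db / tau.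
    by rewrite /C4; ring.
  apply: lerD; first exact: HE.
  apply: (le_trans HJ); apply: ler_peMr => //.
  by apply: mulr_ge0 => //; apply: mulr_ge0 => //; apply: mulr_ge0.
apply: (le_trans (ler_normD _ _)).
apply: (le_trans (lerD (ler_normD _ _) (lexx _))).
apply: (le_trans (lerD (lerD (ler_normD _ _) (lexx _)) (lexx _))).
apply: (le_trans (lerD (lerD (lerD F1 F2) F3) F4)).
rewrite le_eqVlt; apply/orP; left; apply/eqP; rewrite /C5; ring.
Qed.

(** With times closer than eta, the errors in [rect_approx] are absorbed in a
fraction of the main term: T times the bound C2 by the choice of e1, and 1/tau, which is
at most sqrt eta times tau^(-3/2) up to a constant, by the choice of e2. *)
Lemma rect_local_estimate : exists eta D1 D2 : R, [/\ 0 < eta, 0 < D1, 0 < D2 &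
  forall s' s t t', 0 <= s' -> s' <= s -> s < t -> t <= t' -> t' <= H ->
  (t' - t) + (s - s') <= t - s -> t' - s' <= eta ->
  - D2 * pow_m32 (t - s) * ((t' - t) * (s - s')) <=
    rho s t' - rho s t - rho s' t' + rho s' t <=
  - D1 * pow_m32 (t' - s') * ((t' - t) * (s - s'))].
Proof.
pose e1 := A / (8 * M0 * (C2 + 1)).
pose e2 := (k1 / (8 * (C5 + 1))) ^+ 2.
have C21 : 0 < C2 + 1 by rewrite ltr_wpDl.
have C51 : 0 < C5 + 1 by rewrite ltr_wpDl.
have e1_gt0 : 0 < e1 by apply: divr_gt0 => //; apply: mulr_gt0 => //; apply: mulr_gt0.
have e2_gt0 : 0 < e2 by apply: exprn_gt0; apply: divr_gt0 => //; apply: mulr_gt0.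
pose eta := Num.min (Num.min d0 2^-1) (Num.min e1 e2).
have eta_gt0 : 0 < eta by rewrite !lt_min d0_gt0 e1_gt0 e2_gt0 invr_gt0 ltr0n.
pose D2 := A^-1 / 4 + A^-1 * C2 + C5 + 1.
have D2_gt0 : 0 < D2.
  rewrite /D2 ltr_wpDl//; apply: addr_ge0 => //; apply: addr_ge0.
    by apply: divr_ge0.
  exact: mulr_ge0.
exists eta, (k1 / 4), D2; split => //; first exact: divr_gt0.
move=> s' s t t' s'0 ss st tt t'H hab.
rewrite !le_min => /andP[/andP[hd hh] /andP[he1 he2]].
have [T [X [tT Tt XL]]] := rect_approx s'0 ss st tt t'H hab hd hh.
rewrite /rect; set Rc := rho s t' - _ - _ + _.
have da0 : 0 <= t' - t by rewrite subr_ge0.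
have db0 : 0 <= s - s' by rewrite subr_ge0.
set m := (t' - t) * (s - s').
have m0 : 0 <= m by exact: mulr_ge0.
have tau0 : 0 < t - s by rewrite subr_gt0.
have tmax : t' - s' <= 2 * (t - s).
  have -> : t' - s' = (t - s) + ((t' - t) + (s - s')) by ring.
  by rewrite mulr_natl mulr2n lerD2l.
move: hab hd hh he1 he2 tT Tt tmax tau0 XL.
set tau := t - s; set tm := t' - s'; set g := heat T X / T.
move=> hab hd hh he1 he2 tT Tt tmax tau0 XL.
have T0 : 0 < T by exact: lt_le_trans tT.
have tm0 : 0 < tm by exact: lt_le_trans Tt.
have T1 : T <= 1 by rewrite (le_trans Tt)// (le_trans hh)// invf_le1// ler1n.
have tm1 : tm <= 1 by rewrite (le_trans hh)// invf_le1// ler1n.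
have tau1 : tau <= 1 by rewrite (le_trans tT).
have hE : heat T X = T * g by rewrite /g mulrC divfK// gt_eqF.
rewrite hE => /ler_normlP[lo up].
have g0 : 0 < g by rewrite divr_gt0// heat_gt0.
have gS : g <= pow_m32 T by exact: heat_div_le.
have Sg : kappa * expR (- L ^+ 2) * pow_m32 T <= g by exact: heat_div_ge.
have STt : pow_m32 T <= pow_m32 tau by exact: pow_m32_anti.
have STm : pow_m32 tm <= pow_m32 T by exact: pow_m32_anti.
have Stm0 := pow_m32_gt0 tm0.
have /andP[beta0 beta1] : M0^-1 <= b t' <= A^-1.
  apply: b_bnd; rewrite t'H (le_trans s'0)// (le_trans ss)// (le_trans (ltW st))//.
have iM0 : 0 < M0^-1 by rewrite invr_gt0.
have C5tau : C5 * m / tau <= k1 / 4 * pow_m32 tm * m.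
  have it : tau^-1 <= 2 * tm^-1.
    have -> : 2 * tm^-1 = (tm / 2)^-1 by rewrite invfM invrK mulrC.
    by rewrite lef_pV2 ?posrE ?divr_gt0// ler_pdivrMr// mulrC.
  have itm := inv_le_pow_m32 tm0 he2.
  have e2s : Num.sqrt e2 = k1 / (8 * (C5 + 1)).
    by rewrite sqrtr_sqr ger0_norm// ltW// divr_gt0// mulr_gt0.
  rewrite e2s in itm.
  have -> : C5 * m / tau = C5 * tau^-1 * m by ring.
  apply: ler_wpM2r => //.
  apply: (@le_trans _ _ (C5 * (2 * (k1 / (8 * (C5 + 1)) * pow_m32 tm)))).
    by apply: ler_wpM2l => //; apply: (le_trans it); rewrite ler_pM2l.
  have -> : C5 * (2 * (k1 / (8 * (C5 + 1)) * pow_m32 tm)) = (C5 / (C5 + 1)) * (k1 / 4 * pow_m32 tm).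
    by field; rewrite gt_eqF.
  rewrite ler_piMl//; first by rewrite ltW// mulr_gt0// divr_gt0.
  by rewrite ler_pdivrMr// mul1r lerDl.
have C5tau' : C5 * m / tau <= C5 * pow_m32 tau * m.
  rewrite mulrAC; apply: ler_wpM2r => //; apply: ler_wpM2l => //.
  by have := inv_le_pow_m32 tau0 tau1; rewrite sqrtr1 mul1r.
have gm0 : 0 <= g * m by rewrite mulr_ge0// ltW.
have Gup : A^-1 * (T * g * (C2 * m)) <= M0^-1 / 8 * (g * m).
  have -> : A^-1 * (T * g * (C2 * m)) = (A^-1 * T * C2) * (g * m) by ring.
  apply: ler_wpM2r => //.
  have Te : T <= e1 by exact: le_trans Tt he1.
  apply: (@le_trans _ _ (A^-1 * e1 * (C2 + 1))).
    apply: ler_pM => //; first by rewrite mulr_ge0// ltW.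
      by rewrite ler_wpM2l.
    by rewrite lerDl.
  by rewrite le_eqVlt; apply/orP; left; apply/eqP; rewrite /e1; field; rewrite !gt_eqF.
have Glo : A^-1 * (T * g * (C2 * m)) <= A^-1 * C2 * (pow_m32 tau * m).
  have -> : A^-1 * (T * g * (C2 * m)) = A^-1 * C2 * (T * g * m) by ring.
  apply: ler_wpM2l; first exact: mulr_ge0.
  apply: ler_wpM2r => //.
  by rewrite (le_trans (ler_piMl (ltW g0) T1))// (le_trans gS).
have U1 : M0^-1 * (g * (m / 4)) <= b t' * (g * (m / 4)).
  by apply: ler_wpM2r => //; apply: mulr_ge0; [exact: ltW|exact: divr_ge0].
have U2 : b t' * (g * (m / 4)) <= A^-1 * (pow_m32 tau * (m / 4)).
  have m4 : 0 <= m / 4 by exact: divr_ge0.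
  apply: ler_pM => //.
  - by apply: le_trans beta0; exact: ltW.
  - by apply: mulr_ge0 => //; exact: ltW.
  - by apply: ler_wpM2r => //; exact: le_trans STt.
have U3 : k1 / 2 * pow_m32 tm * m <= M0^-1 / 8 * (g * m).
  have -> : k1 / 2 * pow_m32 tm * m = M0^-1 / 8 * (kappa * expR (- L ^+ 2) * pow_m32 tm * m).
    by rewrite /k1; move: (kappa * _) => kk; field; rewrite gt_eqF.
  apply: ler_wpM2l; first by rewrite divr_ge0// ltW.
  apply: ler_wpM2r => //; apply: le_trans Sg; apply: ler_wpM2l => //.
have Sm : 0 <= pow_m32 tau * m by apply: mulr_ge0 => //; apply: ltW; exact: pow_m32_gt0.
rewrite -(mulrA C5) in lo up C5tau C5tau'.
exact: (combine_estimates lo up C5tau C5tau' Gup Glo U1 U2 U3 Sm).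
Qed.
End local_estimate.

(** * Bisection of rectangles *)

(** Halving both sides halves the ratio of the sides to the gap, so finitely many
steps reduce to rectangles with sides smaller than their gap. The quarters have
gaps between t - s and t' - s', and four times the bound for a quarter is the
bound for the rectangle. *)
Lemma rect_bisect (R : realType) (rho : R -> R -> R) (H eta D1 D2 : R) :
  0 <= D1 -> 0 <= D2 ->
  (forall s' s t t', 0 <= s' -> s' <= s -> s < t -> t <= t' -> t' <= H ->
    (t' - t) + (s - s') <= t - s -> t' - s' <= eta ->
    - D2 * pow_m32 (t - s) * ((t' - t) * (s - s')) <=
      rho s t' - rho s t - rho s' t' + rho s' t <=
    - D1 * pow_m32 (t' - s') * ((t' - t) * (s - s'))) ->
  forall s' s t t', 0 <= s' -> s' <= s -> s < t -> t <= t' -> t' <= H ->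
    t' - s' <= eta ->
    - D2 * pow_m32 (t - s) * ((t' - t) * (s - s')) <=
      rho s t' - rho s t - rho s' t' + rho s' t <=
    - D1 * pow_m32 (t' - s') * ((t' - t) * (s - s')).
Proof.
move=> D1_ge0 D2_ge0 H0.
suff Hn n : forall s' s t t', 0 <= s' -> s' <= s -> s < t -> t <= t' -> t' <= H ->
    (t' - t) + (s - s') <= 2 ^+ n * (t - s) -> t' - s' <= eta ->
    - D2 * pow_m32 (t - s) * ((t' - t) * (s - s')) <=
      rho s t' - rho s t - rho s' t' + rho s' t <=
    - D1 * pow_m32 (t' - s') * ((t' - t) * (s - s')).
  move=> s' s t t' s'0 ss st tt tH he.
  have ts0 : 0 < t - s by rewrite subr_gt0.
  pose n := Num.bound (((t' - t) + (s - s')) / (t - s)).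
  apply: (Hn n) => //; rewrite -ler_pdivrMr//.
  have r0 : 0 <= ((t' - t) + (s - s')) / (t - s).
    by rewrite divr_ge0 ?(ltW ts0)// addr_ge0 ?subr_ge0.
  apply: le_trans (ltW (archi_boundP r0)) _.
  by rewrite -natrX ler_nat; apply/ltnW/ltn_expl.
elim: n => [|n IH] s' s t t' s'0 ss st tt tH hab he.
  by apply: H0 => //; move: hab; rewrite expr0 mul1r.
pose sm := (s + s') / 2; pose tm := (t + t') / 2.
have sm1 : s' <= sm by rewrite /sm; lra.
have sm2 : sm <= s by rewrite /sm; lra.
have tm1 : t <= tm by rewrite /tm; lra.
have tm2 : tm <= t' by rewrite /tm; lra.
have sm0 : 0 <= sm by lra.
have hm : (t' - t) / 2 + (s - s') / 2 <= 2 ^+ n * (t - s).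
  move: hab; rewrite exprS -mulrA; lra.
have p2 : 0 <= 2 ^+ n :> R by rewrite exprn_ge0.
have mono g : t - s <= g -> 2 ^+ n * (t - s) <= 2 ^+ n * g by exact: ler_wpM2l.
have et1 : tm - t = (t' - t) / 2 by rewrite /tm; field.
have et2 : t' - tm = (t' - t) / 2 by rewrite /tm; field.
have es1 : sm - s' = (s - s') / 2 by rewrite /sm; field.
have es2 : s - sm = (s - s') / 2 by rewrite /sm; field.
pose m := (t' - t) / 2 * ((s - s') / 2).
have m0 : 0 <= m by rewrite mulr_ge0// divr_ge0// subr_ge0.
have ts0 : 0 < t - s by rewrite subr_gt0.
have lowS g : t - s <= g -> - D2 * pow_m32 (t - s) * m <= - D2 * pow_m32 g * m.
  move=> tg; apply: ler_wpM2r => //; rewrite !mulNr lerN2; apply: ler_wpM2l => //.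
  exact: pow_m32_anti.
have upS g : 0 < g -> g <= t' - s' -> - D1 * pow_m32 g * m <= - D1 * pow_m32 (t' - s') * m.
  move=> g0 tg; apply: ler_wpM2r => //; rewrite !mulNr lerN2; apply: ler_wpM2l => //.
  exact: pow_m32_anti.
have step s1 s2 t1 t2 : s2 - s1 = (s - s') / 2 -> t2 - t1 = (t' - t) / 2 ->
  s' <= s1 -> s2 <= s -> t <= t1 -> t2 <= t' ->
  - D2 * pow_m32 (t - s) * m <= rho s2 t2 - rho s2 t1 - rho s1 t2 + rho s1 t1
    <= - D1 * pow_m32 (t' - s') * m.
  move=> es et hs1 hs2 ht1 ht2.
  have s12 : s1 <= s2 by lra.
  have t12 : t1 <= t2 by lra.
  have ts12 : s2 < t1 by lra.
  have gap : t - s <= t1 - s2 by lra.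
  have gap2 : t2 - s1 <= t' - s' by lra.
  have g0 : 0 < t2 - s1 by lra.
  have := IH s1 s2 t1 t2 (le_trans s'0 hs1) s12 ts12 t12 (le_trans ht2 tH).
  rewrite es et -/m => /(_ (le_trans hm (mono _ gap)) (le_trans gap2 he)) /andP[lo up].
  by rewrite (le_trans (lowS _ gap) lo) (le_trans up (upS _ g0 gap2)).
have /andP[a1 a2] := step s' sm t tm es1 et1 (lexx _) sm2 (lexx _) tm2.
have /andP[b1 b2] := step s' sm tm t' es1 et2 (lexx _) sm2 tm1 (lexx _).
have /andP[c1 c2] := step sm s t tm es2 et1 sm1 (lexx _) (lexx _) tm2.
have /andP[d1 d2] := step sm s tm t' es2 et2 sm1 (lexx _) tm1 (lexx _).
have -> : (t' - t) * (s - s') = m + m + m + m by rewrite /m; field.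
rewrite !mulrDr; move: a1 a2 b1 b2 c1 c2 d1 d2.
move: (- D2 * _ * m) (- D1 * _ * m) => X Y.
move: (rho s' t) (rho s' tm) (rho s' t') (rho sm t) (rho sm tm) (rho sm t')
  (rho s t) (rho s tm) (rho s t') => r1 r2 r3 r4 r5 r6 r7 r8 r9.
by clear; move=> *; apply/andP; split; lra.
Qed.

(** * Laws of the Brownian motion *)

Section product_law.
Context d d1 d2 (T : measurableType d) (T1 : measurableType d1) (T2 : measurableType d2)
  (R : realType) (P : probability T R).
Variables (m1 : probability T1 R) (m2 : probability T2 R) (X : T -> T1) (Y : T -> T2).
Hypotheses (mX : measurable_fun setT X) (mY : measurable_fun setT Y).
Hypothesis ind : forall A D, measurable A -> measurable D ->
  P (X @^-1` A `&` Y @^-1` D) = (m1 A * m2 D)%E.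

(** Independence, an identity on rectangles, determines the joint law. *)
Lemma product_law E : measurable E -> P [set w | E (X w, Y w)] = (m1 \x m2)%E E.
Proof.
move=> mE.
have mXY : measurable_fun setT (fun w => (X w, Y w)) by exact: measurable_fun_pair.
pose V : {mfun T >-> (T1 * T2)%type} :=
  HB.pack (fun w => (X w, Y w)) (isMeasurableFun.Build _ _ _ _ _ mXY).
by rewrite (product_measure_unique (m' := distribution P V)).
Qed.
End product_law.

Section brownian.
Context {R : realType} d (T : measurableType d) (P : probability T R).
Variable B : R -> {RV P >-> R}.
Hypothesis hB : brownian_motion B.

(** B(s) = B(0) + W(s), where B(0) is independent of the pair (W(s), W(t) - W(s));
conditioning on B(0) reduces the claim to the independence of W(s) and
W(t) - W(s). *)
Lemma brownian_indep s t A D : 0 <= s -> s < t -> measurable A -> measurable D ->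
  P (B s @^-1` A `&` (fun w => B t w - B s w) @^-1` D) =
  (distribution P (B s) A * normal_prob 0 (Num.sqrt (t - s)) D)%E.
Proof.
move=> s0 st mA; have [W [[W0 Wind Wlaw _] B0ind BE]] := hB.
have t0 : 0 <= t by apply: le_trans (ltW st).
have mW r : measurable_fun setT (W r) by exact: measurable_funPT.
pose V w := (W s w, W t w - W s w).
have mV : measurable_fun setT V by apply: measurable_fun_pair => //; exact: measurable_funB.
pose Vf : {mfun T >-> (R * R)%type} :=
  HB.pack V (isMeasurableFun.Build _ _ _ _ _ mV).
pose law2 : probability _ R := distribution P Vf.
(* The generated sigma-algebra is made the canonical one of a type, so that the
   measurability of the pair follows from that of its components. *)
have Vsig E : measurable E -> sigma_process W `[0, +oo[ (V @^-1` E).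
  move=> mE.
  pose G := \bigcup_(r in `[0, +oo[) preimage_set_system setT (W r) measurable.
  have mWG r : 0 <= r -> measurable_fun [set: g_sigma_algebraType G] (W r : g_sigma_algebraType G -> R).
    move=> r0 _ U mU; apply: sub_sigma_algebra; exists r; first by rewrite /= in_itv/= r0.
    by exists U.
  have mVG : measurable_fun [set: g_sigma_algebraType G] (V : g_sigma_algebraType G -> R * R).
    by apply: measurable_fun_pair; [exact: mWG|apply: measurable_funB; exact: mWG].
  by have := mVG measurableT E mE; rewrite setTI.
have indV A' E : measurable A' -> measurable E ->
    P (B 0 @^-1` A' `&` V @^-1` E) = (distribution P (B 0) A' * law2 E)%E.
  move=> mA' mE; rewrite B0ind//; last exact: Vsig.
  by exists A' => //; rewrite setTI.
have mB0 : measurable_fun setT (B 0) by exact: measurable_funPT.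
have PL := product_law mB0 mV indV.
pose S (D' : set R) : set (R * (R * R)) := [set x | A (x.1 + x.2.1) /\ D' x.2.2].
have mS D' : measurable D' -> measurable (S D').
  move=> mD.
  have h1 : measurable_fun setT (fun x : R * (R * R) => x.1 + x.2.1).
    apply: measurable_funD; first exact: measurable_fst.
    by apply: measurableT_comp; [exact: measurable_fst|exact: measurable_snd].
  have h2 : measurable_fun setT (fun x : R * (R * R) => x.2.2).
    by apply: measurableT_comp; exact: measurable_snd.
  have := measurableI _ _ (h1 measurableT A mA) (h2 measurableT D' mD).
  by rewrite !setTI.
have SE D' : measurable D' -> P (B s @^-1` A `&` (fun w => B t w - B s w) @^-1` D') =
   (\int[distribution P (B 0)]_x law2 (xsection (S D') x))%E.
  move=> mD; rewrite -[RHS]/((distribution P (B 0) \x law2)%E (S D')) -PL; last exact: mS.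
  congr (P _); apply/seteqP; split=> w /=; rewrite /S/= (BE s)// (BE t)//.
    by move=> [a b]; split => //; move: b; congr D'; ring.
  by move=> [a b]; split => //; move: b; congr D'; ring.
have Wprod D' x : measurable D' -> law2 (xsection (S D') x) =
   (law2 (xsection (S setT) x) * normal_prob 0 (Num.sqrt (t - s)) D')%E.
  move=> mD; pose C := [set y | A (x + y)].
  have mC : measurable C.
    have h : measurable_fun setT (fun y : R => x + y) by exact: measurable_funD.
    by have := h measurableT A mA; rewrite setTI.
  have E D'' : law2 (xsection (S D'') x) = P (W s @^-1` C `&` (W t \- W s) @^-1` D'').
    congr (P _); apply/seteqP; split => w /=.
      by move/xsectionP.
    by move=> H; apply/xsectionP.
  rewrite !E (Wind s t)//; last 2 first.
  - apply: sub_sigma_algebra; exists s; first by rewrite /= in_itv/= s0 lexx.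
    by exists C => //; rewrite setTI.
  - by exists D' => //; rewrite setTI.
  by rewrite preimage_setT setIT Wlaw.
move=> mD; rewrite SE//.
under eq_integral do rewrite Wprod//.
rewrite ge0_integralZr//; last first.
  exact: (measurable_fun_xsection law2 (mS _ measurableT)).
by rewrite -SE// preimage_setT setIT.
Qed.

(** Integrating first over B(s), for a fixed value y of the increment, only
involves the distribution function of B(s). *)
Lemma brownian_joint s t E : 0 <= s -> s < t -> measurable E ->
  P [set w | E (B s w, B t w - B s w)] =
  (\int[lebesgue_measure]_y ((heat (t - s) y)%:E * distribution P (B s) (ysection E y)))%E.
Proof.
move=> s0 st mE.
have mB r : measurable_fun setT (B r) by exact: measurable_funPT.
have mi : measurable_fun setT (fun w => B t w - B s w) by exact: measurable_funB.
rewrite (product_law (mB s) mi (m1 := distribution P (B s))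
  (m2 := normal_prob 0 (Num.sqrt (t - s))))//; last first.
  by move=> A D mA mD; exact: brownian_indep.
have ts0 : 0 < t - s by rewrite subr_gt0.
rewrite /product_measure1 /=.
pose f (xy : R * R) := ((heat (t - s) xy.2)%:E * (\1_E xy)%:E)%E.
have mf : measurable_fun setT f.
  apply: emeasurable_funM.
    apply/measurable_EFinP/measurableT_comp; last exact: measurable_snd.
    exact: measurable_heat0.
  by apply/measurable_EFinP; exact: measurable_indic.
have f0 xy : (0 <= f xy)%E.
  by rewrite mule_ge0// lee_fin// ltW// heat_gt0.
have := fubini_tonelli (m1 := distribution P (B s)) (m2 := @lebesgue_measure R) f mf f0.
set I1 := (X in X = _); set I2 := (X in _ = X); move=> I12.
transitivity I1.
  apply: eq_integral => x _ /=; rewrite /normal_prob.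
  rewrite integral_mkcond; apply: eq_integral => y _; rewrite patchE /f/= indicE.
  rewrite mem_xsection heat_normal_pdf// subr0.
  by case: ifPn => _; rewrite ?mule1 ?mule0.
rewrite I12; apply: eq_integral => y _.
have mEy : measurable (ysection E y) by exact: measurable_ysection.
rewrite /f (eq_integral (fun x => (heat (t - s) y)%:E * (\1_(ysection E y) x)%:E)%E); last first.
  by move=> x _; rewrite !indicE mem_ysection.
rewrite ge0_integralZl//; last by rewrite lee_fin ltW// heat_gt0.
  by rewrite integral_indic// setIT.
by apply/measurable_EFinP; exact: measurable_indic.
Qed.

End brownian.

Section level_sets.
Context {R : realType} d (T : measurableType d).

Lemma measurable_sublevel (f : T -> R) c : measurable_fun setT f ->
  measurable [set z | f z <= c].
Proof.
move=> mf; rewrite (_ : [set z | _] = f @^-1` `]-oo, c]).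
  by rewrite -[X in measurable X]setTI; exact: mf.
by apply/seteqP; split => z /=; rewrite in_itv.
Qed.

Lemma measurable_superlevel (f : T -> R) c : measurable_fun setT f ->
  measurable [set z | c < f z].
Proof.
move=> mf; rewrite (_ : [set z | _] = f @^-1` `]c, +oo[).
  by rewrite -[X in measurable X]setTI; exact: mf.
by apply/seteqP; split => z /=; rewrite in_itv/= andbT.
Qed.
End level_sets.

Section cdf.
Context {R : realType} d (T : measurableType d) (P : probability T R).
Variable B : R -> {RV P >-> R}.
Implicit Types s t x y a b : R.

Definition Cdf x t : R := fine (distribution P (B t) `]-oo, x]).

Lemma CdfE x t : (Cdf x t)%:E = distribution P (B t) `]-oo, x].
Proof. by rewrite /Cdf fineK// fin_num_measure. Qed.

Lemma Cdf_homo t : {homo Cdf ^~ t : x y / x <= y}.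
Proof.
move=> x y xy; rewrite -lee_fin !CdfE; apply: le_measure; rewrite ?inE//.
by move=> z /=; rewrite !in_itv/= => /le_trans; apply.
Qed.

Lemma Cdf_itv t a b : distribution P (B t) `]a, b] = (Num.max 0 (Cdf b t - Cdf a t))%:E.
Proof.
have [ab|ba] := leP a b; last first.
  rewrite set_itv_ge ?measure0; last by rewrite bnd_simp -leNgt ltW.
  by rewrite max_l// subr_le0; exact/Cdf_homo/ltW.
rewrite max_r ?subr_ge0; last exact: Cdf_homo.
rewrite EFinB !CdfE (_ : `]a, b]%classic = `]-oo, b] `\` `]-oo, a]); last first.
  apply/seteqP; split => z /=; rewrite !in_itv/=.
    move=> /andP[az zb]; split=> // za.
    by move: (lt_le_trans az za); rewrite ltxx.
  by move=> [zb /negP]; rewrite -ltNge zb => ->.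
rewrite measureD//=; last by rewrite ltey_eq fin_num_measure.
congr (_ - _)%E; congr (distribution _ _ _); apply/seteqP; split => z /=; rewrite !in_itv/=.
  by case.
by move=> za; split=> //; exact: le_trans ab.
Qed.

Hypothesis hB : brownian_motion B.

Lemma Cdf_evol s t x : 0 <= s -> s < t ->
  Cdf x t = \int[lebesgue_measure]_y (Cdf (x - y) s * heat (t - s) y).
Proof.
move=> s0 st; rewrite /Rintegral {1}/Cdf; congr fine.
pose E : set (R * R) := [set z | z.1 + z.2 <= x].
have mE : measurable E.
  apply: measurable_sublevel.
  by apply: measurable_funD; [exact: measurable_fst|exact: measurable_snd].
transitivity (P [set w | E (B s w, B t w - B s w)]).
  congr (P _); apply/seteqP; split => w; rewrite /E/= in_itv/=;
    by rewrite addrC subrK.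
rewrite (brownian_joint hB s0 st mE); apply: eq_integral => y _.
rewrite muleC (EFinM (Cdf _ _)) CdfE; congr (distribution _ _ _ * _)%E.
by apply/seteqP; split => z /=; rewrite in_itv/= ysectionE/= /E/= lerBrDr.
Qed.

Lemma joint_cdf s t a b : 0 <= s -> s < t ->
  fine (P ([set w | B s w <= a] `&` [set w | B t w <= b])) =
  Cdf a s - \int[lebesgue_measure]_y (Num.max 0 (Cdf a s - Cdf (b - y) s) * heat (t - s) y).
Proof.
move=> s0 st.
pose E : set (R * R) := [set z | z.1 <= a] `&` [set z | b < z.1 + z.2].
have mE : measurable E.
  apply: measurableI; first by apply: measurable_sublevel; exact: measurable_fst.
  apply: measurable_superlevel.
  by apply: measurable_funD; [exact: measurable_fst|exact: measurable_snd].
have -> : \int[lebesgue_measure]_y (Num.max 0 (Cdf a s - Cdf (b - y) s) * heat (t - s) y)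
    = fine (P [set w | E (B s w, B t w - B s w)]).
  rewrite (brownian_joint hB s0 st mE); congr fine; apply: eq_integral => y _.
  rewrite muleC (EFinM (Num.max _ _)) -Cdf_itv; congr (distribution _ _ _ * _)%E.
  apply/seteqP; split => z /=; rewrite in_itv/= ysectionE/= /E/= ltrBlDr.
    by case/andP.
  by case=> -> ->.
have mB r : measurable_fun setT (B r) by exact: measurable_funPT.
have mle r c : measurable [set w | B r w <= c] by exact: measurable_sublevel.
have mgt r c : measurable [set w | c < B r w] by exact: measurable_superlevel.
apply/eqP; rewrite eq_sym subr_eq; apply/eqP.
have -> : [set w | E (B s w, B t w - B s w)] = [set w | B s w <= a] `&` [set w | b < B t w].
  by apply/seteqP; split => w /=; rewrite /E/= addrC subrK.
rewrite -fineD ?fin_num_measure//; [|exact: measurableI..].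
rewrite -measureU//; [|exact: measurableI|exact: measurableI|]; last first.
  apply/seteqP; split => w //= [[_ h1] [_ h2]].
  by move: (lt_le_trans h2 h1); rewrite ltxx.
rewrite -setIUr /Cdf; congr (fine (P _)); apply/seteqP; split => w /=.
  rewrite in_itv/= => ha; split => //.
  by have [h|h] := leP (B t w) b; [left|right].
by case; rewrite in_itv.
Qed.

End cdf.

(** * Distribution functions and their derivatives *)

Section density.
Context {R : realType} d (T : measurableType d) (P : probability T R).
Variable B : R -> {RV P >-> R}.

Lemma is_derive_Cdf (t : R) (v : R -> R) (x : R) : continuous v ->
  is_density (distribution P (B t)) v -> is_derive x 1 (Cdf B ^~ t) (v x).
Proof.
move=> cv [v0 mv Hv].
have iv : (@lebesgue_measure R).-integrable setT (EFin \o v).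
  apply/integrableP; split; first exact/measurable_EFinP.
  under eq_integral do rewrite /= ger0_norm//.
  by rewrite -Hv// probability_setT ltry.
have E : Cdf B ^~ t = fun x => \int[lebesgue_measure]_(y in `]-oo, x]) v y.
  by apply/funext => y; rewrite /Cdf /Rintegral Hv.
have xx : x < x + 1 by rewrite ltrDl.
have [] := @continuous_FTC1 R v -oo%O x (x + 1) xx _ _ (cv x).
- by apply: integrableS iv.
- by rewrite ltNyr.
rewrite -E => D1 D2; apply: DeriveDef => //.
by rewrite -D2 derive1E.
Qed.
End density.

Section derivative_bounds.
Context {R : realType}.
Implicit Types (F : R -> R) (x a M h : R).

(** Bounds on increments pass to the derivative; they are the form in which
information on the density is propagated in time. *)
Lemma is_derive_le F x a M r : is_derive x 1 F a -> 0 < r ->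
  (forall h, 0 < h -> h <= r -> F (x + h) - F x <= M * h) -> a <= M.
Proof.
move=> dF r0 H; rewrite leNgt; apply/negP => Ma.
have cF : (fun h : R => h^-1 *: (F (h *: 1 + x) - F x)) @ 0^' --> a.
  have <- : 'D_1 F x = a by exact: derive_val.
  have := @ex_derive _ _ _ _ _ _ _ dF; exact.
have aM : 0 < a - M by rewrite subr_gt0.
have : \forall h \near (0 : R)^', `|a - h^-1 *: (F (h *: 1 + x) - F x)| < a - M.
  by move/cvgrPdist_lt: cF; apply.
rewrite near_withinE => /nbhs_ballP[e /= e0 He].
pose g := Num.min (e / 2) r.
have g0 : 0 < g by rewrite lt_min r0 divr_gt0.
have /He/(_ _) : ball (0 : R) e g.
  rewrite /ball/= sub0r normrN gtr0_norm// (@le_lt_trans _ _ (e / 2))//.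
    by rewrite ge_min lexx.
  by rewrite ltr_pdivrMr// mulr_natr mulr2n ltrDr.
rewrite gt_eqF// => /(_ isT) Hh.
have Hq : g^-1 * (F (g * 1 + x) - F x) <= M.
  by rewrite mulrC ler_pdivrMr// mulr1 (addrC g) H// ge_min lexx orbT.
have := le_lt_trans (ler_norm _) Hh; rewrite /GRing.scale/=; move: Hq; lra.
Qed.

Lemma is_derive_norm_le F x a M : is_derive x 1 F a ->
  (forall h, 0 < h -> `|F (x + h) - F x| <= M * h) -> `|a| <= M.
Proof.
move=> dF H; rewrite ler_norml; apply/andP; split.
  rewrite lerNl; apply: (is_derive_le (der_opp dF) ltr01) => h h0 _.
  by have := H _ h0; rewrite ler_norml => /andP[]; lra.
by apply: (is_derive_le dF ltr01) => h h0 _; rewrite (le_trans (ler_norm _))// H.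
Qed.
End derivative_bounds.

Section reflection.
Context {R : realType}.
Notation mu := (@lebesgue_measure R).

Lemma integral_opp (G : R -> R) : continuous G -> (forall x, 0 <= G x) ->
  (\int[mu]_x (G x)%:E = \int[mu]_x (G (- x))%:E)%E.
Proof.
move=> cG G0.
have S (F : R -> R) : continuous F -> (forall x, 0 <= F x) ->
   (\int[mu]_x (F x)%:E = \int[mu]_(x in `[0%R, +oo[) (F x)%:E + \int[mu]_(x in `[0%R, +oo[) (F (- x))%:E)%E.
  move=> cF F0.
  have mF : measurable_fun setT F by exact: continuous_measurable_fun.
  have -> : setT = `[0%R, +oo[%classic `|` `]-oo, 0%R[%classic :> set R.
    apply/seteqP; split => // z _ /=; rewrite !in_itv/= andbT.
    by have [z0|z0] := leP 0 z; [left|right].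
  rewrite ge0_integral_setU//; first last.
  - rewrite disj_set2E; apply/eqP/seteqP; split => z //=; rewrite !in_itv/= andbT.
    by case => z0; rewrite ltNge z0.
  - by move=> z _; rewrite lee_fin.
  - by apply/measurable_EFinP; exact: measurable_funTS.
  congr (_ + _)%E.
  rewrite integral_itv_bndo_bndc; last by apply/measurable_EFinP; exact: measurable_funTS.
  have := @ge0_integration_by_substitutionNy R F 0; rewrite oppr0 => -> //.
    exact: continuous_subspaceT.
rewrite (S G)// (S (G \o -%R)).
- rewrite addeC; congr (_ + _)%E; apply: eq_integral => z _ //=.
  by rewrite opprK.
- move=> z; apply: continuous_comp; [exact: opp_continuous|exact: cG].
- by move=> z /=.
Qed.

Lemma integral_shift (G : R -> R) z : continuous G -> (forall x, 0 <= G x) ->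
  (\int[mu]_x (G x)%:E = \int[mu]_x (G (x + z))%:E)%E.
Proof.
move=> cG G0.
have D1 : derive1 (fun x : R => x + z) = cst (1 : R).
  apply/funext => x; rewrite derive1E.
  have D := der_add (der_id x) (der_cst z x); rewrite addr0 in D.
  exact: derive_val.
rewrite (@increasing_ge0_integration_by_substitutionT R (fun x => x + z) G)//.
- by apply: eq_integral => x _; rewrite D1 /= mulr1.
- by move=> x y xy; rewrite ltrD2r.
- by rewrite D1 => x; exact: cvg_cst.
- by rewrite D1; exact: is_cvg_cst.
- by rewrite D1; exact: is_cvg_cst.
- exact: cvg_addrr_Ny.
- exact: cvg_addrr.
Qed.
End reflection.

(** * Functions propagated by Gaussian averages *)

Section evolution.
Context {R : realType}.
Notation mu := (@lebesgue_measure R).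
Implicit Types (Phi : R -> R -> R) (s t x y h k c : R).

(** Bounded functions of (x,t) propagated by the heat semigroup. The distribution
functions are such, and the property is stable under taking increments in x,
which plays the role of differentiating in x. *)
Definition evolves Phi : Prop := exists M : R,
  [/\ forall s x, 0 <= s -> `|Phi x s| <= M,
      forall s, 0 <= s -> continuous (Phi ^~ s)
    & forall s t x, 0 <= s -> s < t ->
        Phi x t = \int[mu]_y (Phi (x - y) s * heat (t - s) y)].

Definition incr h Phi x s := Phi (x + h) s - Phi x s.

Lemma bounded_heat_integrable (G : R -> R) M t : 0 < t ->
  measurable_fun setT G -> (forall y, `|G y| <= M) ->
  mu.-integrable setT (EFin \o (fun y => G y * heat t y)).
Proof.
move=> t0 mG GM; apply: (@integrable_heat_dom _ _ M t t0).
  by apply: measurable_funM => //; exact: measurable_heat0.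
by move=> y; rewrite normrM (ger0_norm (ltW (heat_gt0 _ _))) ler_wpM2r// ltW// heat_gt0.
Qed.

Lemma continuous_reflect (G : R -> R) x : continuous G -> continuous (fun y => G (x - y)).
Proof.
move=> cG y; apply: continuous_comp; last exact: cG.
by apply: cvgB; [exact: cvg_cst|exact: cvg_id].
Qed.

Lemma continuous_translate (G : R -> R) x : continuous G -> continuous (fun y => G (y + x)).
Proof.
move=> cG y; apply: continuous_comp; last exact: cG.
by apply: cvgD; [exact: cvg_id|exact: cvg_cst].
Qed.

Lemma evolves_incr h Phi : evolves Phi -> evolves (incr h Phi).
Proof.
move=> [M [bM cP eP]]; exists (2 * M); split.
- move=> s x s0; rewrite (le_trans (ler_normB _ _))// mulr_natl mulr2n.
  by apply: lerD; exact: bM.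
- move=> s s0 x; apply: cvgB; last exact: cP.
  have := @continuous_translate (Phi ^~ s) h (cP s s0) x; exact.
- move=> s t x s0 st; rewrite /incr (eP s t)// (eP s t)//.
  have ts0 : 0 < t - s by rewrite subr_gt0.
  have mP z : measurable_fun setT (fun y => Phi (z - y) s).
    by apply: continuous_measurable_fun; exact: continuous_reflect (cP s s0).
  have iP z : mu.-integrable setT (EFin \o (fun y => Phi (z - y) s * heat (t - s) y)).
    by apply: (bounded_heat_integrable (M := M)) => // y; exact: bM.
  rewrite -RintegralB//; apply: eq_Rintegral => y _.
  by rewrite -mulrBl addrAC.
Qed.

Lemma evolves_bound c Phi : evolves Phi -> (forall x, `|Phi x 0| <= c) ->
  forall t x, 0 <= t -> `|Phi x t| <= c.
Proof.
move=> [M [bM cP eP]] H t x; rewrite le_eqVlt => /predU1P[<-//|t0].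
rewrite (eP 0 t)// subr0; apply: (Rintegral_heat_le t0).
  apply: measurable_funM; last exact: measurable_heat0.
  by apply: continuous_measurable_fun; apply: continuous_reflect (cP _ _).
move=> y; rewrite normrM (ger0_norm (ltW (heat_gt0 _ _))).
by rewrite ler_wpM2r// ltW// heat_gt0.
Qed.

Lemma heat_even t y : heat t (- y) = heat t y.
Proof. by rewrite /heat sqrrN. Qed.

(** Adding the bound M makes the integrand nonnegative, as [integral_opp]
requires. *)
Lemma Rintegral_heat_opp (G : R -> R) M t : 0 < t -> continuous G ->
  (forall y, `|G y| <= M) ->
  \int[mu]_y (G (- y) * heat t y) = \int[mu]_y (G y * heat t y).
Proof.
move=> t0 cG GM.
have cG' : continuous (fun y => G (- y)).
  by move=> y; apply: continuous_comp; [exact: opp_continuous|exact: cG].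
have mG := continuous_measurable_fun cG; have mG' := continuous_measurable_fun cG'.
have iG := bounded_heat_integrable t0 mG GM.
have iG' := bounded_heat_integrable t0 mG' (fun y => GM (- y)).
have iM := integrableZl measurableT M (integrable_heat t0).
have sh (F : R -> R) : mu.-integrable setT (EFin \o (fun y => F y * heat t y)) ->
  \int[mu]_y ((F y + M) * heat t y) = \int[mu]_y (F y * heat t y) + \int[mu]_y (M * heat t y).
  by move=> iF; rewrite -RintegralD//; apply: eq_Rintegral => y _; rewrite mulrDl.
apply: (@addIr _ (\int[mu]_y (M * heat t y))); rewrite -!sh//.
rewrite /Rintegral (@integral_opp R (fun y => (G y + M) * heat t y)).
- by congr fine; apply: eq_integral => y _; rewrite heat_even.
- move=> y; apply: cvgM; last exact: continuous_heat.
  by apply: cvgD; [exact: cG|exact: cvg_cst].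
- move=> y; rewrite mulr_ge0 ?(ltW (heat_gt0 _ _))//.
  by have := GM y; rewrite ler_norml => /andP[]; rewrite lerNl -lerBlDr sub0r lerNl.
Qed.

(** By symmetry of the Gaussian, 2 (Phi x t - Phi x s) is the average of the
symmetric second increments of Phi(.,s), and y^2 averages to O(t - s). *)
Lemma evolves_time c Phi s t x : evolves Phi -> 0 <= s -> s < t ->
  (forall y, `|Phi (x + y) s + Phi (x - y) s - 2 * Phi x s| <= c * y ^+ 2) ->
  `|Phi x t - Phi x s| <= 4 * c * (t - s).
Proof.
move=> [M [bM cP eP]] s0 st H.
have ts0 : 0 < t - s by rewrite subr_gt0.
set tau := t - s in ts0 *.
have c1 : continuous (fun y => Phi (x - y) s) by exact: continuous_reflect (cP s s0).
have c2 : continuous (fun y => Phi (x + y) s).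
  by under eq_fun do rewrite addrC; exact: continuous_translate (cP s s0).
have E1 : Phi x t = \int[mu]_y (Phi (x - y) s * heat tau y) by exact: eP.
have E2 : Phi x t = \int[mu]_y (Phi (x + y) s * heat tau y).
  rewrite E1 -(@Rintegral_heat_opp (fun y => Phi (x - y) s) M)//; last first.
    by move=> y; exact: bM.
  by apply: eq_Rintegral => y _; rewrite opprK.
have m1 := continuous_measurable_fun c1; have m2 := continuous_measurable_fun c2.
have i1 := bounded_heat_integrable ts0 m1 (fun y => bM s (x - y) s0).
have i2 := bounded_heat_integrable ts0 m2 (fun y => bM s (x + y) s0).
have i3 := integrableZl measurableT (2 * Phi x s) (integrable_heat ts0).
have E3 : 2 * Phi x s = \int[mu]_y (2 * Phi x s * heat tau y).
  rewrite RintegralZl//; last exact: integrable_heat.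
  by rewrite /Rintegral integral_heat// mulr1.
have E4 : 2 * (Phi x t - Phi x s) =
   \int[mu]_y ((Phi (x + y) s + Phi (x - y) s - 2 * Phi x s) * heat tau y).
  rewrite mulrBr {1}(_ : 2 * Phi x t = Phi x t + Phi x t); last by ring.
  rewrite {1}E2 {1}E1 {1}E3 -RintegralD// -RintegralB//.
    by apply: eq_Rintegral => y _; ring.
  exact: integrableD i2 i1.
have t2 : 0 < 2 * tau by rewrite mulr_gt0.
have B : `|2 * (Phi x t - Phi x s)| <= c * (8 * tau).
  rewrite E4; apply: (Rintegral_heat_le t2).
    apply: measurable_funM; last exact: measurable_heat0.
    by apply: measurable_funB => //; exact: measurable_funD.
  move=> y; rewrite normrM (ger0_norm (ltW (heat_gt0 _ _))).
  apply: (le_trans (ler_wpM2r (ltW (heat_gt0 _ _)) (H y))).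
  have t8 : 0 < tau / 8 by rewrite divr_gt0.
  have := heat_sqr_le y t8.
  have -> : 8 * (tau / 8) = tau by field.
  have -> : 64 * (tau / 8) = 8 * tau by field.
  have -> : 16 * (tau / 8) = 2 * tau by field.
  have c0 : 0 <= c by have := le_trans (normr_ge0 _) (H 1); rewrite expr1n mulr1.
  by move=> K; rewrite -[leLHS]mulrA -[leRHS]mulrA ler_wpM2l.
move: B; rewrite normrM (ger0_norm (ler0n _ 2)); lra.
Qed.

End evolution.

(** * Regularity of the density *)

Section regularity.
Context {R : realType}.
Notation mu := (@lebesgue_measure R).
Implicit Types (x y s t h : R).

Lemma derive_incr_le (F F' : R -> R) M x h :
  (forall x, is_derive x 1 F (F' x)) -> (forall x, `|F' x| <= M) ->
  `|F (x + h) - F x| <= M * `|h|.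
Proof.
move=> dF bF.
suff S y k : 0 <= k -> `|F (y + k) - F y| <= M * `|k|.
  have [h0|h0] := leP 0 h; first exact: S.
  have := S (x + h) (- h); rewrite oppr_ge0 => /(_ (ltW h0)).
  by rewrite addrK distrC normrN.
move=> k0; have yk : y <= y + k by rewrite lerDl.
have [c _ ->] := mean_value yk (fun x _ => dF x).
by rewrite addrC addKr normrM ler_wpM2r.
Qed.

Variables (C u : R -> R -> R) (f1 f2 : R -> R) (M0 M1 M2 : R).
Hypotheses (eC : evolves C)
  (dC : forall t x, 0 <= t -> is_derive x 1 (C ^~ t) (u x t))
  (u_ge0 : forall t x, 0 <= t -> 0 <= u x t)
  (bu : forall x, u x 0 <= M0)
  (du : forall x, is_derive x 1 (u ^~ 0) (f1 x)) (bf1 : forall x, `|f1 x| <= M1)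
  (df1 : forall x, is_derive x 1 f1 (f2 x)) (bf2 : forall x, `|f2 x| <= M2).

Let dshift (F : R -> R) h x a : is_derive (x + h) 1 F a ->
  is_derive x 1 (fun y => F (y + h)) a.
Proof.
move=> dF; have d1 := der_add (der_id x) (der_cst h x).
by apply: (der_eq (der_comp d1 dF)); rewrite addr0 mulr1.
Qed.

Let dincr (F : R -> R) h x a b : is_derive (x + h) 1 F a -> is_derive x 1 F b ->
  is_derive x 1 (fun y => F (y + h) - F y) (a - b).
Proof. by move=> da db; exact: der_add (dshift da) (der_opp db). Qed.

Let C_incr h x t : 0 <= t -> `|incr h C x t| <= M0 * `|h|.
Proof.
move: t x; apply: (fun P t x => @evolves_bound R (M0 * `|h|) _ (evolves_incr h eC) P t x) => x.
apply: (derive_incr_le _ _ (fun x => dC x (lexx 0))) => z.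
by rewrite ger0_norm ?bu ?u_ge0.
Qed.

(** Increments of order two (resp. three) at time 0 are products of the step sizes
and of a bound on the first (resp. second) derivative of the initial density. *)
Let C_incr2 h k x t : 0 <= t -> `|incr h (incr k C) x t| <= M1 * `|k| * `|h|.
Proof.
move: t x; apply: (fun P t x => @evolves_bound R (M1 * `|k| * `|h|) _ (evolves_incr h (evolves_incr k eC)) P t x) => x.
apply: (derive_incr_le _ _ (fun x => dincr (dC (x + k) (lexx 0)) (dC x (lexx 0)))) => z.
exact: (derive_incr_le _ _ du bf1).
Qed.

Let C_incr3 h k l x t : 0 <= t ->
  `|incr h (incr k (incr l C)) x t| <= M2 * `|l| * `|k| * `|h|.
Proof.
move: t x; apply: (fun P t x => @evolves_bound R (M2 * `|l| * `|k| * `|h|) _ (evolves_incr h (evolves_incr k (evolves_incr l eC))) P t x) => x.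
have d1 z := dincr (dC (z + l) (lexx 0)) (dC z (lexx 0)).
apply: (derive_incr_le _ _ (fun z => dincr (d1 (z + k)) (d1 z))) => z.
apply: (derive_incr_le _ _ (fun z => dincr (du (z + l)) (du z))) => w.
exact: (derive_incr_le _ _ df1 bf2).
Qed.

Lemma density_le t x : 0 <= t -> u x t <= M0.
Proof.
move=> t0; apply: (is_derive_le (dC x t0) ltr01) => h h0 _.
by have := C_incr h x t0; rewrite (gtr0_norm h0); apply: le_trans; exact: ler_norm.
Qed.

Lemma density_lipschitz t x y : 0 <= t -> `|u x t - u y t| <= M1 * `|x - y|.
Proof.
move=> t0; rewrite (_ : u x t = u (y + (x - y)) t); last by congr u; ring.
apply: (is_derive_norm_le (dincr (dC (y + (x - y)) t0) (dC y t0))) => h h0.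
by have := C_incr2 h (x - y) y t0; rewrite (gtr0_norm h0).
Qed.

Let C_time_lt s t x : 0 <= s -> s < t -> `|C x t - C x s| <= 4 * M1 * (t - s).
Proof.
move=> s0 st; apply: (evolves_time eC s0 st) => y.
have := C_incr2 y y (x - y) s0; rewrite /incr -mulrA -normrM ger0_norm -?expr2 ?sqr_ge0//.
by apply: le_trans; rewrite le_eqVlt; apply/orP; left; apply/eqP; congr `|_|; rewrite subrK; ring.
Qed.

Lemma Cdf_time s t x : 0 <= s -> 0 <= t -> `|C x t - C x s| <= 4 * M1 * `|t - s|.
Proof.
move=> s0 t0; have [st|ts|->] := ltgtP s t.
- by rewrite (gtr0_norm (_ : 0 < t - s)) ?subr_gt0//; exact: C_time_lt.
- by rewrite distrC (distrC t) (gtr0_norm (_ : 0 < s - t)) ?subr_gt0//; exact: C_time_lt.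
- by rewrite !subrr normr0 mulr0.
Qed.

Let incr_time_lt k s t x : 0 <= s -> s < t ->
  `|incr k C x t - incr k C x s| <= 4 * (M2 * `|k|) * (t - s).
Proof.
move=> s0 st; apply: (evolves_time (evolves_incr k eC) s0 st) => y.
have := C_incr3 y y k (x - y) s0; rewrite -(mulrA _ `|y|) -normrM (@ger0_norm _ (y * y)) -?expr2 ?sqr_ge0//.
apply: le_trans; rewrite le_eqVlt; apply/orP; left; apply/eqP; congr `|_|.
by rewrite /incr !subrK; ring.
Qed.

Lemma density_time s t x : 0 <= s -> 0 <= t -> `|u x t - u x s| <= 4 * M2 * `|t - s|.
Proof.
suff S s' t' : 0 <= s' -> s' < t' -> `|u x t' - u x s'| <= 4 * M2 * `|t' - s'|.
  move=> s0 t0; have [st|ts|->] := ltgtP s t; [exact: S| |].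
    by rewrite distrC (distrC t); exact: S.
  by rewrite !subrr normr0 mulr0.
move=> s0 st; have t0 : 0 <= t' by rewrite (le_trans s0)// ltW.
apply: (is_derive_norm_le (der_add (dC x t0) (der_opp (dC x s0)))) => h h0.
rewrite (gtr0_norm (_ : 0 < t' - s')) ?subr_gt0//.
have := incr_time_lt h x s0 st; rewrite (gtr0_norm h0) => H.
have -> : 4 * M2 * (t' - s') * h = 4 * (M2 * h) * (t' - s') by ring.
apply: le_trans H; rewrite le_eqVlt; apply/orP; left; apply/eqP; congr `|_|.
by rewrite /incr; ring.
Qed.

(** The initial density exceeds a positive c on an interval around x0, and the
Gaussian gives positive mass to every interval. *)
Lemma density_gt0 t x x0 : 0 < u x0 0 -> 0 < t -> 0 < u x t.
Proof.
move=> ux0 t0.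
have M1_ge0 : 0 <= M1 by rewrite (le_trans (normr_ge0 _) (bf1 0)).
pose c := u x0 0 / 2; have c0 : 0 < c by rewrite divr_gt0.
pose r := c / (2 * (M1 + 1)).
have M11 : 0 < M1 + 1 by rewrite ltr_wpDl.
have r0 : 0 < r by rewrite divr_gt0// mulr_gt0.
have ul z : `|z - x0| <= 2 * r -> c <= u z 0.
  move=> zr; have := @density_lipschitz 0 z x0 (lexx 0).
  have : M1 * `|z - x0| <= c.
    apply: (@le_trans _ _ ((M1 + 1) * (2 * r))); first by rewrite ler_pM// lerDl.
    by rewrite /r le_eqVlt; apply/orP; left; apply/eqP; field; rewrite gt_eqF.
  move=> h1 /le_trans-/(_ _ h1); rewrite ler_norml => /andP[+ _].
  by rewrite /c; lra.
have Cmono z h : 0 <= h -> 0 <= incr h C z 0.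
  move=> h0; have zh : z <= z + h by rewrite lerDl.
  have [w _ E] := mean_value zh (fun y _ => dC y (lexx 0)).
  by rewrite /incr E mulr_ge0 ?u_ge0 ?subr_ge0.
have Clow z h : `|z - x0| <= r -> 0 <= h -> h <= r -> c * h <= incr h C z 0.
  move=> zr h0 hr; have zh : z <= z + h by rewrite lerDl.
  have [w /andP[zw wh] E] := mean_value zh (fun y _ => dC y (lexx 0)).
  rewrite /incr E (addrC z) addrK ler_wpM2r// ul//.
  have -> : w - x0 = (z - x0) + (w - z) by ring.
  rewrite (le_trans (ler_normD _ _))// mulr_natl mulr2n lerD//.
  by rewrite ger0_norm ?subr_ge0// (le_trans _ hr)// lerBlDr addrC.
pose I : set R := `[x - x0 - r, x - x0 + r]%classic.
pose k := heat t (`|x - x0| + r).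
have k0 : 0 < k := heat_gt0 _ _.
have Hk y : y \in I -> k <= heat t y.
  rewrite inE /I/= in_itv/= => /andP[y1 y2].
  rewrite /k /heat ler_pM2r ?invr_gt0 ?sqrtr_gt0 ?mulr_gt0 ?pi_gt0// ler_expR lerD2r.
  rewrite ler_pM2r ?invr_gt0 ?mulr_gt0// lerN2 -(@real_normK _ y) ?num_real//.
  rewrite ler_pXn2r ?nnegrE ?addr_ge0// ?(ltW r0)//.
  have := ler_norm (x - x0); have := ler_norm (- (x - x0)); rewrite normrN => h1 h2.
  rewrite ler_norml; apply/andP; split; move: y1 y2 h1 h2; lra.
suff : c * (k * (2 * r)) <= u x t by apply: lt_le_trans; apply: mulr_gt0 => //; apply: mulr_gt0 => //; apply: mulr_gt0.
rewrite -lerN2; apply: (is_derive_le (der_opp (dC x (ltW t0))) r0) => h h0 hr.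
have -> : - C (x + h) t - - C x t = - incr h C x t by rewrite /incr; ring.
rewrite mulNr lerN2.
have [M [bM cP eP]] := evolves_incr h eC.
rewrite (eP 0 t)// subr0.
have mI : measurable I by exact: measurable_itv.
have mP : measurable_fun setT (fun y => incr h C (x - y) 0).
  by apply: continuous_measurable_fun; have := @continuous_reflect R (incr h C ^~ 0) x (cP 0 (lexx 0)); exact.
have iP := bounded_heat_integrable t0 mP (fun y => bM 0 (x - y) (lexx 0)).
have muI : mu I = (2 * r)%:E.
  rewrite /I lebesgue_measure_itv/= lte_fin ltrD2l gtrN// -EFinB; congr EFin; ring.
have iI : mu.-integrable setT (EFin \o (\1_I : R -> R)).
  apply/integrableP; split; first by apply/measurable_EFinP; exact: measurable_indic.
  under eq_integral do rewrite /= ger0_norm//.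
  by rewrite integral_indic// setIT [X in (X < _)%E](_ : _ = (2 * r)%:E) ?ltry.
have -> : c * (k * (2 * r)) * h = \int[mu]_y (c * h * k * \1_I y).
  rewrite RintegralZl// /Rintegral integral_indic// setIT.
  by rewrite [X in fine X](_ : _ = (2 * r)%:E)//=; ring.
apply: le_Rintegral => //; first exact: integrableZl iI.
move=> y _; rewrite indicE; have [yI|yI] := boolP (y \in I); last first.
  by rewrite mulr0 mulr_ge0 ?Cmono ?(ltW h0)// ltW// heat_gt0.
rewrite mulr1; apply: ler_pM; [|exact: ltW| |exact: Hk].
  by apply: mulr_ge0; exact: ltW.
apply: Clow; [|exact: ltW|exact: hr].
by move: yI; rewrite inE /I/= in_itv/= ler_norml => /andP[y1 y2]; apply/andP; split; lra.
Qed.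

End regularity.

(** * Regularity of the quantile *)

Section quantile.
Context {R : realType}.
Implicit Types (x y s t : R).
Variables (C u : R -> R -> R) (q : R -> R) (alpha M K1 K2 : R).
Hypotheses (M_gt0 : 0 < M) (K1_ge0 : 0 <= K1) (K2_ge0 : 0 <= K2)
  (dC : forall t x, 0 <= t -> is_derive x 1 (C ^~ t) (u x t))
  (u_ge0 : forall t x, 0 <= t -> 0 <= u x t)
  (u_lip : forall t x y, 0 <= t -> `|u x t - u y t| <= M * `|x - y|)
  (u_time : forall s t x, 0 <= s -> 0 <= t -> `|u x t - u x s| <= K2 * `|t - s|)
  (C_time : forall s t x, 0 <= s -> 0 <= t -> `|C x t - C x s| <= K1 * `|t - s|)
  (hq : forall t, 0 <= t -> C (q t) t = alpha)
  (u_gt0 : forall t, 0 <= t -> 0 < u (q t) t).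

Let C_homo t x y : 0 <= t -> x <= y -> C x t <= C y t.
Proof.
move=> t0 xy; have [c _ E] := mean_value xy (fun z _ => dC z t0).
by rewrite -subr_ge0 E mulr_ge0 ?u_ge0 ?subr_ge0.
Qed.

Let u_low A s x : 0 <= s -> A <= u (q s) s -> `|x - q s| <= A / (2 * M) -> A / 2 <= u x s.
Proof.
move=> s0 As xs; have := u_lip x (q s) s0.
have : M * `|x - q s| <= A / 2.
  apply: (le_trans (ler_wpM2l (ltW M_gt0) xs)).
  by rewrite le_eqVlt; apply/orP; left; apply/eqP; field; rewrite gt_eqF.
move=> h1 /le_trans-/(_ _ h1); rewrite ler_norml => /andP[+ _]; move: As; lra.
Qed.

(** Near the quantile the density is at least A / 2, so C(.,s) leaves the value
alpha at least linearly; [quantile_local_lipschitz] compares this growth with the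
slow variation of C in time. *)
Let C_up A s y : 0 <= s -> A <= u (q s) s -> 0 <= y -> y <= A / (2 * M) ->
  alpha + A / 2 * y <= C (q s + y) s /\ C (q s - y) s <= alpha - A / 2 * y.
Proof.
move=> s0 As y0 yA; split.
  have xy : q s <= q s + y by rewrite lerDl.
  have [c /andP[c1 c2] E] := mean_value xy (fun z _ => dC z s0).
  rewrite -lerBrDl -(hq s0) E (addrC (q s)) addrK ler_wpM2r//.
  apply: u_low As _ => //; rewrite ger0_norm ?subr_ge0//.
  by rewrite (le_trans _ yA)// lerBlDr addrC.
have xy : q s - y <= q s by rewrite lerBlDr lerDl.
have [c /andP[c1 c2] E] := mean_value xy (fun z _ => dC z s0).
rewrite lerBrDl -lerBrDr -(hq s0) E opprB addrC subrK ler_wpM2r//.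
apply: u_low As _ => //; rewrite distrC ger0_norm ?subr_ge0//.
by rewrite (le_trans _ yA)// lerBlDr -lerBlDl.
Qed.

Lemma quantile_local_lipschitz A s t : 0 < A -> 0 <= s -> 0 <= t -> A <= u (q s) s ->
  K1 * `|t - s| < A ^+ 2 / (4 * M) -> `|q t - q s| <= 2 * K1 / A * `|t - s|.
Proof.
move=> A0 s0 t0 As small.
pose eta := A / (2 * M).
have eta0 : 0 < eta by rewrite divr_gt0// mulr_gt0.
have small' : K1 * `|t - s| < A / 2 * eta.
  have -> // : A / 2 * eta = A ^+ 2 / (4 * M) by rewrite /eta; field; rewrite gt_eqF.
(* Truncation at eta keeps the argument where C_up applies; as the variation of C
   in time is too small to reach eta, the truncation turns out to be inactive. *)
set w := q t - q s; pose y := Num.min `|w| eta.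
have y0 : 0 <= y by rewrite le_min normr_ge0 ltW.
have yw : y <= `|w| by rewrite ge_min lexx.
have ye : y <= eta by rewrite ge_min lexx orbT.
have key : A / 2 * y <= K1 * `|t - s|.
  have [up lo] := C_up s0 As y0 ye.
  have [w0|w0] := leP 0 w.
    have qy : q s + y <= q t by rewrite -lerBrDl -/w -(ger0_norm w0).
    have h1 := C_homo t0 qy; rewrite (hq t0) in h1.
    have := C_time (q s + y) s0 t0; rewrite ler_norml => /andP[+ _].
    by move: h1 up; lra.
  have qy : q t <= q s - y.
    by have : y <= - w; [rewrite -(ltr0_norm w0)|rewrite /w; lra].
  have h1 := C_homo t0 qy; rewrite (hq t0) in h1.
  have := C_time (q s - y) s0 t0; rewrite ler_norml => /andP[_].
  by move: h1 lo; lra.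
have ylt : y < eta by rewrite -(@ltr_pM2l _ (A / 2)) ?divr_gt0// (le_lt_trans key).
have yE : y = `|w|.
  by move: ylt; rewrite /y; case: (leP `|w| eta) => // _; rewrite ltxx.
move: key; rewrite yE => key.
have -> : 2 * K1 / A * `|t - s| = K1 * `|t - s| / (A / 2) by field; rewrite gt_eqF.
by rewrite ler_pdivlMr ?divr_gt0// mulrC.
Qed.

Let a t := u (q t) t.

Let a_lip A s t : 0 < A -> 0 <= s -> 0 <= t -> A <= u (q s) s ->
  K1 * `|t - s| < A ^+ 2 / (4 * M) ->
  `|a t - a s| <= (M * (2 * K1 / A) + K2) * `|t - s|.
Proof.
move=> A0 s0 t0 As small.
have -> : a t - a s = (u (q t) t - u (q s) t) + (u (q s) t - u (q s) s) by rewrite /a; ring.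
rewrite (le_trans (ler_normD _ _))// mulrDl lerD//; last exact: u_time.
rewrite (le_trans (u_lip _ _ t0))// -(mulrA M) ler_wpM2l ?(ltW M_gt0)//.
exact: quantile_local_lipschitz.
Qed.

(** Composing with the absolute value extends the function to all real times. *)
Let a_cont : continuous (fun t => a `|t|).
Proof.
move=> s; apply/cvgrPdist_lt => e e0.
pose A := a `|s|; have A0 : 0 < A by exact: u_gt0.
pose D := M * (2 * K1 / A) + K2 + 1.
have D0 : 0 < D.
  rewrite /D ltr_wpDl// addr_ge0// mulr_ge0 ?(ltW M_gt0)//.
  by rewrite divr_ge0 ?(ltW A0)// mulr_ge0.
pose d := Num.min (e / D) (A ^+ 2 / (4 * M) / (K1 + 1)).
have K11 : 0 < K1 + 1 by rewrite ltr_wpDl.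
have d0 : 0 < d.
  rewrite lt_min !divr_gt0//; first by rewrite exprn_gt0.
  by rewrite mulr_gt0.
near=> t.
have ts : `|t - s| < d.
  rewrite distrC; near: t; have := @cvg_id _ (nbhs s).
  by move/cvgrPdist_lt; apply.
have nn : `| `|t| - `|s| | <= `|t - s| by exact: ler_dist_dist.
rewrite distrC.
have tsd : `| `|t| - `|s| | < d by exact: le_lt_trans ts.
have hs : K1 * `| `|t| - `|s| | < A ^+ 2 / (4 * M).
  apply: (@le_lt_trans _ _ ((K1 + 1) * `| `|t| - `|s| |)).
    by rewrite ler_wpM2r// lerDl.
  rewrite mulrC -ltr_pdivlMr//; apply: lt_le_trans tsd _.
  by rewrite ge_min lexx orbT.
apply: le_lt_trans (a_lip A0 (normr_ge0 s) (normr_ge0 t) (lexx _) hs) _.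
apply: (@le_lt_trans _ _ (D * `| `|t| - `|s| |)).
  by rewrite ler_wpM2r// lerDl.
rewrite mulrC -ltr_pdivlMr//; apply: lt_le_trans tsd _.
by rewrite ge_min lexx.
Unshelve. all: by end_near. Qed.

Lemma quantile_uniform H : 0 < H -> exists A L d0, [/\ 0 < A, 0 <= L, 0 < d0,
  forall t, 0 <= t <= H -> A <= u (q t) t &
  forall s t, 0 <= s <= H -> 0 <= t <= H -> `|t - s| <= d0 ->
     `|q t - q s| <= L * `|t - s|].
Proof.
move=> H0.
have [c _ Hc] := EVT_min (ltW H0) (continuous_subspaceT a_cont).
pose A := a `|c|; have A0 : 0 < A by exact: u_gt0.
have HA t : 0 <= t <= H -> A <= u (q t) t.
  move=> tH; have := Hc t; rewrite in_itv/= => /(_ tH).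
  by case/andP: tH => t0 _; rewrite (ger0_norm t0).
have K11 : 0 < K1 + 1 by rewrite ltr_wpDl.
pose d0 := A ^+ 2 / (4 * M) / (K1 + 1) / 2.
have d00 : 0 < d0.
  by rewrite !divr_gt0//; [rewrite exprn_gt0|rewrite mulr_gt0].
exists A, (2 * K1 / A), d0; split => //.
  by rewrite divr_ge0 ?(ltW A0)// mulr_ge0.
move=> s t sH tH ts; have /andP[s0 _] := sH; have /andP[t0 _] := tH.
apply: quantile_local_lipschitz => //; first exact: HA.
apply: (@lt_le_trans _ _ ((K1 + 1) * (2 * d0))).
  apply: (@le_lt_trans _ _ ((K1 + 1) * d0)); first by rewrite ler_pM// lerDl.
  by rewrite ltr_pM2l// ltr_pMl// ltr1n.
by rewrite /d0 le_eqVlt; apply/orP; left; apply/eqP; field; rewrite !gt_eqF.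
Qed.
End quantile.

(** * Expectations of products of increments *)

Section increments.
Context {R : realType} d (T : measurableType d) (Q : probability T R).

(** An integral that takes a finite value has finite positive and negative parts:
the difference of two infinite integrals is infinite. Hence the covariance formula
alone makes the products of values of F integrable. *)
Lemma expectation_fin_integrable (X : T -> R) (r : R) : measurable_fun setT X ->
  ('E_Q[X] = r%:E)%E -> Q.-integrable setT (EFin \o X).
Proof.
move=> mX; rewrite unlock => E; apply/integrableP; split; first exact/measurable_EFinP.
have mE : measurable_fun setT (EFin \o X) by exact/measurable_EFinP.
have := E; rewrite integralE -[fun x => `|_|%E]/(abse \o (EFin \o X)) fune_abse.
rewrite ge0_integralD//; last 2 first.
- exact: measurable_funepos.
- exact: measurable_funeneg.
have pos0 : (0 <= \int[Q]_x ((EFin \o X)^\+ x))%E by exact: integral_ge0.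
have neg0 : (0 <= \int[Q]_x ((EFin \o X)^\- x))%E by exact: integral_ge0.
move: pos0 neg0.
case: (integral _ _ _) => [a| |]; case: (integral _ _ _) => [b| |] //= _ _ _.
by rewrite -EFinD ltry.
Qed.

Lemma expectation_increments (a b c e : T -> R) (r1 r2 r3 r4 : R) :
  measurable_fun setT a -> measurable_fun setT b ->
  measurable_fun setT c -> measurable_fun setT e ->
  ('E_Q[(a \* c)%R] = r1%:E)%E -> ('E_Q[(a \* e)%R] = r2%:E)%E ->
  ('E_Q[(b \* c)%R] = r3%:E)%E -> ('E_Q[(b \* e)%R] = r4%:E)%E ->
  ('E_Q[((a \- b) \* (c \- e))%R] = (r1 - r2 - r3 + r4)%:E)%E.
Proof.
move=> ma mb mc me E1 E2 E3 E4.
have L (x y : T -> R) r : measurable_fun setT x -> measurable_fun setT y ->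
    ('E_Q[(x \* y)%R] = r%:E)%E -> (x \* y)%R \in Lfun Q 1.
  move=> mx my E; apply/Lfun1_integrable.
  by apply: expectation_fin_integrable E; exact: measurable_funM.
have l1 := L _ _ _ ma mc E1; have l2 := L _ _ _ ma me E2.
have l3 := L _ _ _ mb mc E3; have l4 := L _ _ _ mb me E4.
have -> : ((a \- b) \* (c \- e))%R = ((a \* c \- a \* e) \- (b \* c \- b \* e))%R.
  by apply/funext => w /=; ring.
rewrite !expectationB ?E1 ?E2 ?E3 ?E4//.
- by rewrite -!EFinB; congr EFin; ring.
- exact: rpredB.
- exact: rpredB.
Qed.
End increments.

(** * The covariance of increments *)

Section setup.
Context {R : realType} d (T : measurableType d) (P : probability T R).
Variable B : R -> {RV P >-> R}.
Implicit Types (s t x y a b : R).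

Lemma evolves_Cdf : brownian_motion B ->
  (forall t, 0 <= t -> continuous (Cdf B ^~ t)) -> evolves (Cdf B).
Proof.
move=> hB cC; exists 1; split => //.
- move=> s x _; rewrite ger0_norm; first by rewrite -lee_fin CdfE probability_le1.
  by rewrite -lee_fin CdfE.
- by move=> s t x s0 st; exact: Cdf_evol.
Qed.

(** Centering at the quantiles moves all dependence on the later time into the
kernel. *)
Lemma joint_cdf_shift s t a b : brownian_motion B -> continuous (Cdf B ^~ s) ->
  0 <= s -> s < t ->
  fine (P ([set w | B s w <= a] `&` [set w | B t w <= b])) =
  Cdf B a s - \int[lebesgue_measure]_y
    (Num.max 0 (Cdf B a s - Cdf B (a - y) s) * heat (t - s) (y + (b - a))).
Proof.
move=> hB cC s0 st; rewrite joint_cdf//; congr (_ - _).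
have ts0 : 0 < t - s by rewrite subr_gt0.
rewrite /Rintegral (@integral_shift R (fun y => Num.max 0 (Cdf B a s - Cdf B (b - y) s) * heat (t - s) y) (b - a)).
- congr fine; apply: eq_integral => y _ /=.
  by rewrite (_ : b - (y + (b - a)) = a - y)//; ring.
- move=> y; apply: cvgM; last exact: continuous_heat.
  have E : (fun y => Num.max 0 (Cdf B a s - Cdf B (b - y) s)) =
     (fun y => (0 + (Cdf B a s - Cdf B (b - y) s) + `|0 - (Cdf B a s - Cdf B (b - y) s)|) / 2%:R).
    by apply/funext => z; rewrite maxr_absE.
  rewrite [X in X @ _ --> _]E maxr_absE.
  have cD : (fun y => Cdf B a s - Cdf B (b - y) s) z @[z --> y] --> (Cdf B a s - Cdf B (b - y) s).
    by apply: cvgB; [exact: cvg_cst|exact: (@continuous_reflect R (Cdf B ^~ s) b cC y)].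
  apply: cvgM; last exact: cvg_cst.
  apply: cvgD; first by apply: cvgD => //; exact: cvg_cst.
  by apply: cvg_norm; apply: cvgB => //; exact: cvg_cst.
- by move=> y; rewrite mulr_ge0 ?le_max ?lexx// ltW// heat_gt0.
Qed.

End setup.

Theorem corollary3p5 (R : realType) (alpha : R)
  (d : measure_display) (Omega : measurableType d) (P : probability Omega R)
  (B : R -> {RV P >-> R}) (f : R -> R) (u : R -> R -> R) (q : R -> R)
  (d' : measure_display) (Omega' : measurableType d')
  (Q : probability Omega' R) (F : R -> {RV Q >-> R})
  (halpha : 0 < alpha < 1)
  (hB : brownian_motion B)
  (hf : is_density (distribution P (B 0)) f)
  (hfS : schwartz f)
  (hu : forall t : R, 0 <= t ->
    continuous (u ^~ t) /\ is_density (distribution P (B t)) (u ^~ t))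
  (hu0 : forall x : R, u x 0 = f x)
  (hq : forall t : R, 0 <= t -> is_quantile alpha (distribution P (B t)) (q t))
  (hq0 : forall x : R, is_quantile alpha (distribution P (B 0)) x -> x = q 0)
  (hfq0 : 0 < f (q 0))
  (hF : gaussian_process F)
  (hFpaths : continuous_paths F)
  (hFcentered : forall t : R, 0 <= t -> ('E_Q[F t] = 0)%E)
  (hFcov : forall s t : R, 0 <= s -> 0 <= t ->
    ('E_Q[(F s \* F t)%R] = (quantile_cov B u q alpha s t)%:E)%E) :
  forall T : R, 0 < T ->
  exists delta C1 C2 : R, [/\ 0 < delta, 0 < C1, 0 < C2 &
    forall s t Ds Dt : R,
      0 <= s -> s < t -> t <= T -> 0 < Ds -> 0 < Dt -> 0 <= s - Ds ->
      `|t - s| < delta -> Ds < delta -> Dt < delta ->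
      ((- C2 * `|t - s| `^ (- (3 / 2)) * Ds * Dt)%:E
         <= 'E_Q[((F s \- F (s - Ds)) \* (F (t + Dt) \- F t))%R])%E /\
      ('E_Q[((F s \- F (s - Ds)) \* (F (t + Dt) \- F t))%R]
         <= (- C1 * `|t + Dt - (s - Ds)| `^ (- (3 / 2)) * Ds * Dt)%:E)%E].
Proof.
have cu (t : R) : 0 <= t -> continuous (u ^~ t) by move=> /hu[].
have du (t : R) : 0 <= t -> is_density (distribution P (B t)) (u ^~ t) by move=> /hu[].
have dC (t x : R) : 0 <= t -> is_derive x 1 (Cdf B ^~ t) (u x t).
  by move=> t0; exact: is_derive_Cdf (cu t t0) (du t t0).
have u_ge0 (t x : R) : 0 <= t -> 0 <= u x t by move=> /du[].
have cC (t : R) : 0 <= t -> continuous (Cdf B ^~ t).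
  move=> t0 x; have D := dC t x t0.
  by apply/differentiable_continuous/derivable1_diffP; exact: ex_derive.
have eC := evolves_Cdf hB cC.
have [sf bf] := hfS.
have bnd m : exists2 M, 0 <= M & forall x : R, `|derive1n m f x| <= M.
  have [M HM] := bf 0%N m.
  have M0 : 0 <= M.
    apply: le_trans (HM 0); apply: mulr_ge0 => //; exact: addr_ge0.
  exists M => // x; have := HM x; rewrite expr0.
  have := normr_ge0 (derive1n m f x); lra.
have [M0 M0_ge0 bM0] := bnd 0%N; have [M1 M1_ge0 bM1] := bnd 1%N.
have [M2 M2_ge0 bM2] := bnd 2%N.
have u0E : u ^~ 0 = f by apply/funext => x; exact: hu0.
have dn m (x : R) : is_derive x 1 (derive1n m f) (derive1n m.+1 f x).
  rewrite derive1nS derive1E; apply: DeriveDef => //; exact: sf.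
have bu (x : R) : u x 0 <= M0 + 1.
  by rewrite hu0; have := bM0 x; have := ler_norm (f x); rewrite /= => h1 h2; lra.
have duf (x : R) : is_derive x 1 (u ^~ 0) (derive1n 1 f x) by rewrite u0E; exact: dn 0%N x.
have ule (t x : R) : 0 <= t -> u x t <= M0 + 1 by exact: density_le.
have ulip (t x y : R) : 0 <= t -> `|u x t - u y t| <= M1 * `|x - y|.
  exact: (density_lipschitz eC dC duf bM1).
have utime (s t x : R) : 0 <= s -> 0 <= t -> `|u x t - u x s| <= 4 * M2 * `|t - s|.
  exact: (density_time eC dC duf (dn 1%N) bM2).
have Ctime (s t x : R) : 0 <= s -> 0 <= t ->
    `|Cdf B x t - Cdf B x s| <= 4 * M1 * `|t - s|.
  exact: (Cdf_time eC dC duf bM1).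
have ugt0 (t : R) : 0 <= t -> 0 < u (q t) t.
  rewrite le_eqVlt => /predU1P[<-|t0]; first by rewrite hu0.
  by apply: (@density_gt0 R _ _ _ _ eC dC u_ge0 duf bM1 t (q t) (q 0)) => //; rewrite hu0.
have hqC (t : R) : 0 <= t -> Cdf B (q t) t = alpha.
  by move=> t0; rewrite /Cdf (hq t t0).
move=> T T0.
(* The times t + Dt exceed T, by at most 1. *)
pose H := T + 1; have H0 : 0 < H by rewrite /H; lra.
have M10 : 0 < M1 + 1 by rewrite ltr_wpDl.
have ulip' (t x y : R) : 0 <= t -> `|u x t - u y t| <= (M1 + 1) * `|x - y|.
  by move=> t0; apply: (le_trans (ulip t x y t0)); rewrite ler_wpM2r// lerDl.
have K10 : 0 <= 4 * M1 by exact: mulr_ge0.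
have K20 : 0 <= 4 * M2 by exact: mulr_ge0.
have [A [L [d0 [A0 L0 d00 uA qL]]]] :=
  quantile_uniform M10 K10 K20 dC u_ge0 ulip' utime Ctime hqC ugt0 H0.
pose K s t := alpha - fine (P ([set w | B s w <= q s] `&` [set w | B t w <= q t])).
have hK (s t : R) : 0 <= s -> s < t -> K s t =
    \int[lebesgue_measure]_y (Num.max 0 (alpha - Cdf B (q s - y) s)
       * heat (t - s) (y + (q t - q s))).
  move=> s0 st; rewrite /K (joint_cdf_shift (q s) (q t) hB (cC s s0) s0 st) hqC//.
  by rewrite subKr.
have M01 : 0 < M0 + 1 by rewrite ltr_wpDl.
have uM (t x : R) : 0 <= t -> 0 <= u x t <= M0 + 1.
  by move=> t0; rewrite u_ge0//= ule.
have [eta [D1 [D2 [eta0 D10 D20 Hsmall]]]] :=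
  rect_local_estimate halpha M01 M1_ge0 K20 L0 A0 d00 dC uM ulip utime hqC qL uA hK.
have Hrect := rect_bisect (ltW D10) (ltW D20) Hsmall.
pose delta := Num.min 1 (eta / 3).
have delta0 : 0 < delta by rewrite lt_min ltr01 divr_gt0.
exists delta, D1, D2; split => // s t Ds Dt s0 st tT Ds0 Dt0 sDs hts hDs hDt.
have t0 : 0 <= t by rewrite (le_trans s0)// ltW.
have tDt0 : 0 <= t + Dt by rewrite addr_ge0// ltW.
have /andP[d1 d3] : (delta <= 1) && (delta <= eta / 3) by rewrite -le_min.
have ts0 : 0 < t - s by rewrite subr_gt0.
rewrite (gtr0_norm ts0) in hts *.
have mF r : measurable_fun setT (F r) by exact: measurable_funPT.
rewrite (expectation_increments (mF s) (mF (s - Ds)) (mF (t + Dt)) (mF t)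
  (hFcov _ _ s0 tDt0) (hFcov _ _ s0 t0) (hFcov _ _ sDs tDt0) (hFcov _ _ sDs t0)).
rewrite !lee_fin.
have e1 : s - Ds <= s by rewrite gerBl ltW.
have e2 : t <= t + Dt by rewrite lerDl ltW.
have e3 : t + Dt <= H by rewrite /H; move: tT hDt d1; lra.
have e4 : t + Dt - (s - Ds) <= eta by move: hts hDs hDt d3; lra.
have tsp : 0 < t + Dt - (s - Ds) by move: ts0 Ds0 Dt0; lra.
rewrite (gtr0_norm tsp).
have := Hrect _ _ _ _ sDs e1 st e2 e3 e4.
have -> : t + Dt - t = Dt by ring.
have -> : s - (s - Ds) = Ds by ring.
have QE a b : quantile_cov B u q alpha a b =
    (alpha - K a b - alpha ^+ 2) / (u (q a) a * u (q b) b).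
  by rewrite /quantile_cov /K subKr.
rewrite /pow_m32 !QE => /andP[lo up]; split.
  by apply: le_trans lo; rewrite le_eqVlt; apply/orP; left; apply/eqP; ring.
by apply: (le_trans up); rewrite le_eqVlt; apply/orP; left; apply/eqP; ring.
Qed.
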